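(* Let $H$ be a real Hilbert space, let $\Omega\subset H$ be a nonempty closed convex set, and let $a_0,a_1,a_2,\gamma>0$ and $t_0\ge 0$. Let $F:H\to H$ be $\eta$-Lipschitz continuous, let $g:H\to H$ be $\beta$-Lipschitz continuous, and let $h:\Omega\to\mathbb{R}\cup\{+\infty\}$ be a proper, convex, lower semicontinuous function. Then for each $v_0,v_1,v_2\in H$ there exists a unique strong global solution $w:[t_0,+\infty)\to H$ of the third-order dynamical system $$w^{(3)}(t)+a_2w^{(2)}(t)+a_1w^{(1)}(t)+a_0\left[F(w(t))-P_\Omega^{\gamma h}\big(F(w(t))-\gamma g(w(t))\big)\right]=0,\qquad w^{(j)}(t_0)=v_j,\ j\in\{0,1,2\}.$$
   Context: $w^{(j)}$ denotes the $j$-th derivative of $w$. An operator $T:H\to H$ is $L$-Lipschitz continuous ($L\ge0$) if $\|T(w)-T(v)\|\le L\|w-v\|$ for all $w,v\in H$. The generalized $h$-projection (proximal) operator is, for $\gamma>0$ and $w\in H$, $$P_\Omega^{\gamma h}(w):=\arg\min_{v\in\Omega}\left\{\gamma h(v)+\tfrac12\|w-v\|^2\right\}.$$ A function $w:[t_0,+\infty)\to H$ is a strong global solution of the dynamical system if: (1) for every $j\in\{0,1,2,3\}$, $w^{(j)}:[t_0,+\infty)\to H$ is locally absolutely continuous, i.e. absolutely continuous on each compact interval; (2) the differential equation holds for almost every $t\ge t_0$; (3) $w^{(j)}(t_0)=v_j$ for $j\in\{0,1,2\}$. A function $b$ is absolutely continuous on $[s_0,s_1]$ if there is an integrable $z:[s_0,s_1)\to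 H$ with $b(t)=b(s_0)+\int_{s_0}^t z(s)\,ds$ for all $t\in[s_0,s_1]$. *)

(* Defs.v *)
From mathcomp Require Import all_boot all_order all_algebra sesquilinear.
From mathcomp Require Import all_classical all_reals all_analysis.

Set Implicit Arguments.
Unset Strict Implicit.
Unset Printing Implicit Defensive.

Import Order.TTheory GRing.Theory Num.Theory.
Import numFieldNormedType.Exports.

Local Open Scope classical_set_scope.
Local Open Scope ring_scope.

Section hilbert.
Context {R : realType} {H : completeNormedModType R}.

(* A real Hilbert space is a complete normed space [H] together with an inner
   product [ip] satisfying this predicate. *)
Definition induces_norm (ip : {dot H for idfun}) : Prop :=
  forall x : H, `|x| = Num.sqrt (ip x x).

(* An extended-real-valued function on [Omega] is represented by a function on
   the whole of [H] whose values outside [Omega] are irrelevant. *)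
Definition proper_on (Omega : set H) (h : H -> \bar R) : Prop :=
  (forall v, Omega v -> -oo < h v)%E /\ (exists2 v, Omega v & (h v < +oo)%E).

Definition convex_on (Omega : set H) (h : H -> \bar R) : Prop :=
  forall (k : R) (x y : H), 0 <= k -> k <= 1 -> Omega x -> Omega y ->
  (h (k *: x + (1 - k) *: y)%R <= k%:E * h x + (1 - k)%:E * h y)%E.

(* Lower semicontinuity for the relative topology: in [subspace Omega] the
   points outside [Omega] are isolated, so they impose no condition. *)
Definition lsc_on (Omega : set H) (h : H -> \bar R) : Prop :=
  lower_semicontinuous (h : subspace Omega -> \bar R).

Definition argmin_on (Omega : set H) (f : H -> \bar R) : set H :=
  [set v | Omega v /\ forall u, Omega u -> (f v <= f u)%E].

(* The minimizer, chosen arbitrarily (and [point] if there is none); for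
   [Omega] nonempty closed convex, [h] proper convex lsc and [0 < gamma] it
   exists and is unique. *)
Definition prox (Omega : set H) (gamma : R) (h : H -> \bar R) (w : H) : H :=
  get (argmin_on Omega
    (fun v => (gamma%:E * h v + (2^-1 * `|w - v| ^+ 2)%:E)%E)).

Section bochner.
Context {d : measure_display} {T : measurableType d}.
Variable mu : {measure set T -> \bar R}.

(* The pairs [(A, c)] of [s] stand for the terms \1_A *: c of a simple
   function; the sets need not be disjoint. *)
Definition simple_on (D : set T) (s : seq (set T * H)) : Prop :=
  forall p, p \in s -> measurable p.1 /\ (mu (D `&` p.1) < +oo)%E.

Definition simple_eval (s : seq (set T * H)) (x : T) : H :=
  \sum_(p <- s) (\1_(p.1) x : R) *: p.2.

Definition simple_integral (D : set T) (s : seq (set T * H)) : H :=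
  \sum_(p <- s) fine (mu (D `&` p.1)) *: p.2.

Definition strongly_measurable (D : set T) (f : T -> H) : Prop :=
  exists2 s : nat -> seq (set T * H),
    forall n, simple_on D (s n) &
    {ae mu, forall x, D x -> simple_eval (s n) x @[n --> \oo] --> f x}.

Definition bochner_approx (D : set T) (f : T -> H)
    (s : nat -> seq (set T * H)) : Prop :=
  (forall n, simple_on D (s n)) /\
  (\int[mu]_(x in D) (`|f x - simple_eval (s n) x|%R)%:E)%E @[n --> \oo] -->
    0%E.

Definition bochner_integrable (D : set T) (f : T -> H) : Prop :=
  strongly_measurable D f /\ exists s, bochner_approx D f s.

(* [I] is the Bochner integral of [f] over [D]. *)
Definition has_bochner_integral (D : set T) (f : T -> H) (I : H) : Prop :=
  strongly_measurable D f /\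
  exists2 s, bochner_approx D f s &
             simple_integral D (s n) @[n --> \oo] --> I.

End bochner.

Definition absolutely_continuous_on (s0 s1 : R) (b : R -> H) : Prop :=
  exists2 z : R -> H,
    bochner_integrable (@lebesgue_measure R) `[s0, s1[ z &
    forall t, s0 <= t -> t <= s1 ->
      has_bochner_integral (@lebesgue_measure R) `[s0, t[ z (b t - b s0).

(* Functions on [t0, +oo[ are represented by functions on the whole of [R] of
   which only the values at [t >= t0] are used. *)
Section half_line.
Variable t0 : R.

Definition locally_absolutely_continuous (b : R -> H) : Prop :=
  forall s0 s1, t0 <= s0 -> s0 <= s1 -> absolutely_continuous_on s0 s1 b.

(* Difference quotient at [t] of [w] restricted to [t0, +oo[; its limit is the
   right derivative at [t = t0] and the two-sided one at [t > t0]. *)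
Definition diff_quotient (w : R -> H) (t : R) : set_system H :=
  (s - t)^-1 *: (w s - w t) @[s --> within `[t0, +oo[ t^'].

Definition derivable_from (w : R -> H) (t : R) : Prop :=
  cvg (diff_quotient w t).

Definition derive_from (w : R -> H) (t : R) : H := lim (diff_quotient w t).

Definition nderive (j : nat) (w : R -> H) : R -> H := iter j derive_from w.

Definition strong_global_solution (a0 a1 a2 gamma : R) (Omega : set H)
    (F g : H -> H) (h : H -> \bar R) (v0 v1 v2 : H) (w : R -> H) : Prop :=
  [/\ forall j t, (j < 3)%N -> t0 <= t -> derivable_from (nderive j w) t,
      forall j, (j <= 3)%N -> locally_absolutely_continuous (nderive j w),
      {ae @lebesgue_measure R, forall t, t0 <= t ->
        nderive 3 w t + a2 *: nderive 2 w t + a1 *: nderive 1 w t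
        + a0 *: (F (w t) - prox Omega gamma h (F (w t) - gamma *: g (w t)))
        = 0} &
      [/\ nderive 0 w t0 = v0, nderive 1 w t0 = v1 & nderive 2 w t0 = v2]].

End half_line.
End hilbert.

(* Main.v *)
(* The proximal map is 2-Lipschitz: [gamma h + |w - .|^2 / 2] is bounded below
   because a convex function that is bounded below near a point has a linear
   minorant, minimizing sequences are Cauchy by the parallelogram law, and
   midpoint convexity gives quadratic growth at the minimizer. So the equation
   is a first-order system in H^3 with a Lipschitz right-hand side; Euler
   polygons with dyadic steps converge to a solution on the half-line, and w
   and its first three derivatives are locally Lipschitz.

   A Lipschitz curve b in a Hilbert space is the Bochner integral of a density:
   the dyadic difference quotients of b form a bounded martingale in L^2, whose
   increments are orthogonal, hence a subsequence has summable L^1 increments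
   and converges almost everywhere and in L^1.

   For uniqueness, absolute continuity makes the third derivative of a strong
   solution weakly continuous, so that the equation, valid almost everywhere,
   holds everywhere, and Gronwall's lemma applies to the sum of the squared
   norms of the differences. *)
Require Import Defs.
From HB Require Import structures.
From mathcomp Require Import all_boot all_order all_algebra sesquilinear.
From mathcomp Require Import all_classical all_reals all_analysis.
From mathcomp Require Import measurable_realfun ring lra.

Set Implicit Arguments.
Unset Strict Implicit.
Unset Printing Implicit Defensive.

Import Order.TTheory GRing.Theory Num.Theory.
Import numFieldNormedType.Exports.

Local Open Scope classical_set_scope.
Local Open Scope ring_scope.

(** * Inner product *)

Section inner_product.
Context {R : realType} {H : normedModType R} (ip : {dot H for idfun}).
Hypothesis ip_norm : forall x : H, `|x| = Num.sqrt (ip x x).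

Lemma ipC u v : ip u v = ip v u.
Proof. by rewrite hermC /= expr0 mul1r. Qed.

Lemma ipE x : ip x x = `|x| ^+ 2.
Proof.
rewrite ip_norm sqr_sqrtr//.
have [->|/neq0_dnorm_gt0 /ltW//] := eqVneq x 0.
by rewrite linear0l.
Qed.

Lemma ipDl u v w : ip (u + v) w = ip u w + ip v w.
Proof. exact: linearDl. Qed.

Lemma ipZl (k : R) u v : ip (k *: u) v = k * ip u v.
Proof. by rewrite linearZl_LR. Qed.

Lemma ipNl u v : ip (- u) v = - ip u v.
Proof. exact: linearNl. Qed.

Lemma ipDr u v w : ip w (u + v) = ip w u + ip w v.
Proof. by rewrite ipC ipDl !(ipC _ w). Qed.

Lemma ipZr (k : R) u v : ip u (k *: v) = k * ip u v.
Proof. by rewrite ipC ipZl ipC. Qed.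

Lemma ipNr u v : ip u (- v) = - ip u v.
Proof. by rewrite ipC ipNl ipC. Qed.

Definition ip_lin := (ipDl, ipDr, ipNl, ipNr, ipZl, ipZr).

(** Cauchy-Schwarz, from expanding the squared norm of [|v|^2 u - <u,v> v] and cancelling one factor
    [|v|^2]. *)
Lemma ip_le_norm u v : `|ip u v| <= `|u| * `|v|.
Proof.
have [->|v0] := eqVneq v 0.
  by rewrite -(scale0r 0) ipZr mul0r normr0 mulr_ge0.
have v2 : 0 < `|v| ^+ 2 by rewrite exprn_gt0// normr_gt0.
rewrite -ler_sqr ?nnegrE ?mulr_ge0//.
have : 0 <= `|(`|v| ^+ 2) *: u - ip u v *: v| ^+ 2 by rewrite exprn_ge0.
rewrite -(ipE (_ - _)) !ip_lin !ipE (ipC v u) real_normK ?num_real// exprMn.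
set a := `|u|; set b := `|v| in v2 *; set c := ip u v => h.
by rewrite -(ler_pM2l v2); lra.
Qed.

Lemma ip_cvg (I : Type) (F : set_system I) {FF : Filter F} (u : I -> H) (l e : H) :
  u @ F --> l -> ip (u x) e @[x --> F] --> ip l e.
Proof.
move=> ul; apply/cvgrPdist_le => eps eps0.
(* The [+ 1] keeps the divisor positive when [e = 0]. *)
have e1 : 0 < `|e| + 1 by rewrite ltr_wpDl.
have /cvgrPdist_le/(_ _ (divr_gt0 eps0 e1)) := ul.
apply: filterS => n; rewrite ler_pdivlMr// => zn.
rewrite -ipNl -ipDl (le_trans (ip_le_norm _ _))// (le_trans _ zn)//.
by rewrite ler_wpM2l// lerDl.
Qed.

Lemma normB_sqr u v : `|u - v| ^+ 2 = `|u| ^+ 2 + `|v| ^+ 2 - 2 * ip u v.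
Proof. by rewrite -!ipE !ip_lin (ipC v u); ring. Qed.

(** Parallelogram law, read as strong convexity of [|w - .|^2]: the term [4^-1 |x - y|^2] is the
    source of both Cauchy minimizing sequences and quadratic growth. *)
Lemma norm_midpoint (w x y : H) :
  `|w - (2^-1 *: x + 2^-1 *: y) : H| ^+ 2 =
  2^-1 * `|w - x| ^+ 2 + 2^-1 * `|w - y| ^+ 2 - 4^-1 * `|x - y| ^+ 2 :> R.
Proof.
by rewrite -!ipE !ip_lin (ipC y x) (ipC y w) (ipC x w); field.
Qed.

End inner_product.

(** * Proximal map *)

Section prox_existence.
Context {R : realType} {H : completeNormedModType R} (ip : {dot H for idfun}).
Hypothesis ip_norm : induces_norm ip.

Lemma cauchy_modulus_cvg (u : nat -> H) (e : nat -> R) :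
  (forall n m, (n <= m)%N -> `|u n - u m| <= e n) ->
  e n @[n --> \oo] --> 0 -> cvg (u n @[n --> \oo]).
Proof.
move=> ue /cvgrPdist_lt e0; apply/cauchy_cvgP/cauchy_exP => d d0.
have [N _ eN] := e0 _ d0.
exists (u N); exists N => // n /= Nn.
rewrite -ball_normE /=; apply: le_lt_trans (ue _ _ Nn) _.
by have := eN N (leqnn N); rewrite sub0r normrN => /ltr_normlW.
Qed.

(* Convexity along the rays from [x0] turns a lower bound on a ball centred at
   [x0] into a linear one. *)
Lemma convex_linear_minorant (D : set H) (r : H -> R) (x0 : H) (delta m : R) :
  (forall (k : R) x y, 0 <= k -> k <= 1 -> D x -> D y ->
     D (k *: x + (1 - k) *: y) /\
     r (k *: x + (1 - k) *: y) <= k * r x + (1 - k) * r y) ->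
  D x0 -> 0 < delta ->
  (forall y, D y -> `|y - x0| < delta -> m <= r y) ->
  exists2 K, 0 <= K & forall y, D y -> m - K * `|y - x0| <= r y.
Proof.
move=> cvx Dx0 d0 hm.
have rm : m <= r x0 by apply: hm => //; rewrite subrr normr0.
exists (2 * (r x0 - m) / delta).
  by rewrite divr_ge0 ?(ltW d0)// mulr_ge0// subr_ge0.
move=> y Dy; have [yd|yd] := ltP `|y - x0| delta.
  rewrite (le_trans _ (hm y Dy yd))// gerBl mulr_ge0//.
  by rewrite divr_ge0 ?(ltW d0)// mulr_ge0// subr_ge0.
set rho := `|y - x0| in yd *.
have rho0 : 0 < rho by exact: lt_le_trans yd.
(* Contracting [y] towards [x0] by the factor [l] puts it at distance [delta / 2], inside the ball
   where [m] bounds [r]. *)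
pose l := delta / (2 * rho).
have l0 : 0 < l by rewrite divr_gt0// mulr_gt0.
have l1 : l <= 1 by rewrite /l ler_pdivrMr ?mulr_gt0//; lra.
have [Dz rz] := cvx l y x0 (ltW l0) l1 Dy Dx0.
have : m <= r (l *: y + (1 - l) *: x0).
  apply: hm => //.
  have -> : l *: y + (1 - l) *: x0 - x0 = l *: (y - x0).
    by rewrite scalerBl scale1r scalerBr addrA addrAC addrK.
  rewrite normrZ gtr0_norm// /l -/rho.
  have -> : delta / (2 * rho) * rho = delta / 2 by field; rewrite gt_eqF.
  by lra.
move=> /le_trans/(_ rz) {}rz.
have -> : 2 * (r x0 - m) / delta * rho = (r x0 - m) / l.
  by rewrite /l; field; rewrite !gt_eqF.
rewrite lerBlDr -lerBlDl ler_pdivlMr//.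
rewrite mulrBl.
have := subr_ge0 m (r x0); rewrite rm => /esym rm0.
nra.
Qed.

(** Direct method. Semicontinuity is assumed for varying bounds [c n] because along a minimizing
    sequence [r (u n)] is controlled only by [I + e n - |w - u n|^2 / 2]. *)
Lemma minimizer_exists (D : set H) (r : H -> R) (x0 w : H) (delta m : R) :
  (forall (k : R) x y, 0 <= k -> k <= 1 -> D x -> D y ->
     D (k *: x + (1 - k) *: y) /\
     r (k *: x + (1 - k) *: y) <= k * r x + (1 - k) * r y) ->
  D x0 -> 0 < delta ->
  (forall y, D y -> `|y - x0| < delta -> m <= r y) ->
  (forall (u : nat -> H) (v : H) (c : nat -> R) (l : R),
     (forall n, D (u n) /\ r (u n) <= c n) -> u n @[n --> \oo] --> v ->
     c n @[n --> \oo] --> l -> D v /\ r v <= l) ->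
  exists2 p, D p & forall u, D u ->
    r p + 2^-1 * `|w - p| ^+ 2 <= r u + 2^-1 * `|w - u| ^+ 2.
Proof.
move=> cvx Dx0 d0 hm lsc.
have [K K0 hK] := convex_linear_minorant cvx Dx0 d0 hm.
pose psi u := r u + 2^-1 * `|w - u| ^+ 2.
(* In the linear minorant, [K |w - u|] is absorbed by [|w - u|^2 / 2] at the cost of [K^2 / 2]. *)
have psi_lb u : D u -> m - K * `|w - x0| - K ^+ 2 / 2 <= psi u.
  move=> Du; rewrite /psi.
  have h1 := hK u Du.
  have h2 : `|u - x0| <= `|w - u| + `|w - x0|.
    by rewrite (distrC w u) (le_trans _ (ler_normD _ _))// addrA subrK.
  have := ler_wpM2l K0 h2.
  by have := sqr_ge0 (`|w - u| - K); nra.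
have psi_inf : has_inf (psi @` D).
  split; first by exists (psi x0), x0.
  by exists (m - K * `|w - x0| - K ^+ 2 / 2) => _ [u Du <-]; exact: psi_lb.
pose I := inf (psi @` D).
have I_le u : D u -> I <= psi u.
  by move=> Du; apply: ge_inf; [case: psi_inf|exists u].
pose e n : R := 2^-1 ^+ n.
have e_gt0 n : 0 < e n by rewrite exprn_gt0.
have /choice[u u_min] : forall n, exists u, D u /\ psi u <= I + e n.
  move=> n; have [_ [u Du <-] /ltW] := inf_adherent (e_gt0 n) psi_inf.
  by exists u.
(* The infimum [I] is compared with the value of [psi] at the midpoint of [x] and [y]. *)
have mid x y : D x -> D y -> `|x - y| ^+ 2 <= 4 * (psi x + psi y - 2 * I).
  move=> Dx Dy.
  have half0 : 0 <= 2^-1 :> R by [].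
  have half1 : 2^-1 <= 1 :> R by rewrite invf_le1 ?ler1n.
  have [] := cvx 2^-1 x y half0 half1 Dx Dy.
  have -> : 1 - 2^-1 = 2^-1 :> R by field.
  move=> Dz rz; have := I_le _ Dz; rewrite /psi (norm_midpoint ip_norm).
  by lra.
have e_decr n k : (n <= k)%N -> e k <= e n.
  by move=> nk; rewrite /e ler_wiXn2l// invf_le1 ?ler1n.
have e_cvg : e n @[n --> \oo] --> 0.
  by apply: cvg_expr; rewrite ger0_norm// invf_lt1 ?ltr1n.
have /cvg_ex[/= p up] : cvg (u n @[n --> \oo]).
  (* [mid], with both values of [psi] at most [I + e n], bounds the squared distance by
     [8 * e n]. *)
  apply: (@cauchy_modulus_cvg _ (fun n => Num.sqrt (8 * e n))).
    move=> n k nk.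
    rewrite -(ger0_norm (normr_ge0 (u n - u k))) -sqrtr_sqr ler_wsqrtr//.
    have [Dn un] := u_min n; have [Dk uk] := u_min k.
    by rewrite (le_trans (mid _ _ Dn Dk))//; have := e_decr _ _ nk; lra.
  rewrite -[X in _ --> X](_ : Num.sqrt (8 * 0) = 0); last by rewrite mulr0 sqrtr0.
  by apply: continuous_cvg; [exact: sqrt_continuous|exact: cvgMr].
have [Dp rp] : D p /\ r p <= I + 0 - 2^-1 * `|w - p| ^+ 2.
  apply: (lsc u p (fun n => I + e n - 2^-1 * `|w - u n| ^+ 2)) => //.
    by move=> n; have [Dn] := u_min n; rewrite /psi; split=> //; lra.
  apply: cvgB; first by apply: cvgD => //; exact: cvg_cst.
  apply: cvgMr; rewrite expr2; under eq_cvg do rewrite expr2.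
  by apply: cvgM; apply: cvg_norm; apply: cvgB => //; exact: cvg_cst.
exists p => // v Dv.
by have := I_le v Dv; rewrite /psi; lra.
Qed.

End prox_existence.

(** * Minimality and Lipschitz continuity of the proximal map *)

Section prox.
Context {R : realType} {H : completeNormedModType R} (ip : {dot H for idfun}).
Hypothesis ip_norm : induces_norm ip.
Variables (Omega : set H) (gamma : R) (h : H -> \bar R).
Hypotheses (Omega_closed : closed Omega) (Omega_convex : convex_set Omega).
Hypotheses (gamma_gt0 : 0 < gamma) (h_proper : proper_on Omega h).
Hypotheses (h_convex : convex_on Omega h) (h_lsc : lsc_on Omega h).

(** The effective domain: [h] is finite there, so the real function [r] can stand for [gamma h]. *)
Let D := [set v | Omega v /\ (h v < +oo)%E].
Let r v := gamma * fine (h v).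

Let h_fin v : D v -> h v = (fine (h v))%:E.
Proof.
move=> [Ov hv]; rewrite fineK// fin_numElt hv andbT.
exact: h_proper.1.
Qed.

Let Dr_convex (k : R) x y : 0 <= k -> k <= 1 -> D x -> D y ->
  D (k *: x + (1 - k) *: y) /\
  r (k *: x + (1 - k) *: y) <= k * r x + (1 - k) * r y.
Proof.
move=> k0 k1 Dx Dy.
have Oz : Omega (k *: x + (1 - k) *: y).
  have k01 : Itv.spec (@Itv.num_sem R) (Itv.Real `[0, 1]%Z) k.
    by rewrite /Itv.num_sem/= num_real in_itv/= k0 k1.
  have := Omega_convex (Itv.mk k01) (mem_set Dx.1) (mem_set Dy.1).
  by move/set_mem.
have hz := h_convex k0 k1 Dx.1 Dy.1.
rewrite (h_fin Dx) (h_fin Dy) -!EFinM -EFinD in hz.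
have Dz : D (k *: x + (1 - k) *: y) by split=> //; exact: le_lt_trans hz (ltry _).
split=> //; rewrite (h_fin Dz) lee_fin in hz.
by rewrite /r; have := ler_wpM2l (ltW gamma_gt0) hz; lra.
Qed.

Let h_near v (a : R) : Omega v -> (a%:E < h v)%E ->
  exists2 V, nbhs v V & forall y, Omega y -> V y -> (a%:E < h y)%E.
Proof.
move=> Ov /h_lsc[V vV VP].
have OV : within Omega (nbhs v) V by rewrite (nbhs_subspace_in Ov).
(* Adjoining the complement of [Omega] to [V] turns a relative neighbourhood into an ambient one. *)
by exists [set y | Omega y -> V y] => // y Oy /(_ Oy); exact: VP.
Qed.

(** If [h v] exceeded [l / gamma], a level [a] strictly between them would eventually lie below
    [h (u n)], forcing [a * gamma <= l] in the limit. *)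
Let r_lsc (u : nat -> H) (v : H) (c : nat -> R) (l : R) :
  (forall n, D (u n) /\ r (u n) <= c n) -> u n @[n --> \oo] --> v ->
  c n @[n --> \oo] --> l -> D v /\ r v <= l.
Proof.
move=> Du uv cl.
have Ov : Omega v.
  apply: (closed_cvg Omega Omega_closed _ _ uv).
  by apply: nearW => n; case: (Du n) => -[].
suff hv : (h v <= (l / gamma)%:E)%E.
  have Dv : D v by split=> //; exact: le_lt_trans hv (ltry _).
  split=> //; rewrite (h_fin Dv) lee_fin in hv.
  by rewrite /r mulrC -ler_pdivlMr.
rewrite leNgt; apply/negP => hv.
have [a la ahv] : exists2 a, l / gamma < a & (a%:E < h v)%E.
  case: (h v) hv => [s|_|//]; last by exists (l / gamma + 1); rewrite ?ltry// ltrDl.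
  rewrite lte_fin => ls; exists ((l / gamma + s) / 2); first by lra.
  by rewrite lte_fin; lra.
have [V vV VP] := h_near Ov ahv.
suff : a * gamma <= l by rewrite -ler_pdivlMr// leNgt la.
apply: (ler_cvg_to (cvg_cst (a * gamma)) cl).
near=> n; have [Dn rn] := Du n.
have uV : V (u n) by near: n; exact: uv.
have := VP _ Dn.1 uV; rewrite (h_fin Dn) lte_fin => /ltW au.
by rewrite (le_trans _ rn)// /r mulrC ler_pM2l.
Unshelve. all: by end_near. Qed.

Let D_nonempty : exists x0, D x0.
Proof. by have [_ [x0 Ox0 hx0]] := h_proper; exists x0. Qed.

(** The choice made in [prox] is a minimizer as soon as one exists. The search takes place in the
    effective domain, since the objective is infinite on the rest of [Omega]. *)
Lemma proxP w : let p := prox Omega gamma h w in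
  [/\ Omega p, (h p < +oo)%E & forall u, Omega u -> (h u < +oo)%E ->
    gamma * fine (h p) + 2^-1 * `|w - p| ^+ 2 <=
    gamma * fine (h u) + 2^-1 * `|w - u| ^+ 2].
Proof.
move=> p.
have obj u : D u -> (gamma%:E * h u + (2^-1 * `|w - u| ^+ 2)%:E)%E =
                    (r u + 2^-1 * `|w - u| ^+ 2)%:E.
  by move=> Du; rewrite (h_fin Du).
suff pmin : argmin_on Omega
    (fun v => gamma%:E * h v + (2^-1 * `|w - v| ^+ 2)%:E)%E p.
  have [Op pP] := pmin.
  have Dp : D p.
    split=> //; have [x0 Dx0] := D_nonempty.
    have := pP _ Dx0.1; rewrite (obj _ Dx0); case: (h p) => [s|/=|//].
      by rewrite ltry.
    by rewrite gt0_muley ?lte_fin.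
  split=> //; first exact: Dp.2.
  move=> u Ou hu; have Du : D u by [].
  by have := pP _ Ou; rewrite (obj _ Dp) (obj _ Du) lee_fin.
have [x0 Dx0] := D_nonempty.
(* The threshold [h x0 - 1 / gamma] scales to [r x0 - 1], the local lower bound that
   [minimizer_exists] asks for. *)
have [d d0 hd] : exists2 d, 0 < d & forall y, D y -> `|y - x0| < d ->
    r x0 - 1 <= r y.
  have : ((fine (h x0) - gamma^-1)%:E < h x0)%E.
    by rewrite [ltRHS]h_fin// lte_fin gtrBl invr_gt0.
  move=> /(h_near Dx0.1)[V /nbhs_ballP[d d0 dV] VP].
  exists d => // y Dy yd.
  have yV : V y by apply: dV; rewrite -ball_normE /= distrC.
  have := VP _ Dy.1 yV; rewrite (h_fin Dy) lte_fin => /ltW yh.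
  have := ler_wpM2l (ltW gamma_gt0) yh.
  by rewrite /r mulrBr mulfV ?gt_eqF.
have [q Dq qP] := minimizer_exists ip_norm w Dr_convex Dx0 d0 hd r_lsc.
apply: (@getI _ _ q); split=> [|u Ou]; first exact: Dq.1.
rewrite (obj _ Dq); case: (ltP (h u) +oo%E) => hu.
  have Du : D u by [].
  by rewrite (obj _ Du) lee_fin; exact: qP.
move: hu; rewrite leye_eq => /eqP ->.
by rewrite gt0_muley ?lte_fin// addye// leey.
Qed.

(** Adding the growth inequalities at the two minimizers cancels [r] and leaves
    [|p - q|^2 / 2 <= <p - q, x - y>]. Midpoint convexity gives growth with coefficient [4^-1],
    whence the constant 2 instead of the sharp 1. *)
Lemma prox_lipschitz x y :
  `|prox Omega gamma h x - prox Omega gamma h y| <= 2 * `|x - y|.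
Proof.
have growth w (p := prox Omega gamma h w) u : D u ->
    r p + 2^-1 * `|w - p| ^+ 2 + 4^-1 * `|u - p| ^+ 2 <=
    r u + 2^-1 * `|w - u| ^+ 2.
  move=> Du; have [Op hp pP] := proxP w.
  have [] := @Dr_convex 2^-1 u p _ _ Du (conj Op hp).
  - by [].
  - by rewrite invf_le1 ?ler1n.
  have -> : 1 - 2^-1 = 2^-1 :> R by field.
  move=> [Oz hz] rz; have := pP _ Oz hz.
  by rewrite (norm_midpoint ip_norm) -/p; move: rz; rewrite /r; lra.
set p := prox _ _ _ x; set q := prox _ _ _ y.
have [Op hp _] := proxP x; have [Oq hq _] := proxP y.
have := growth x q (conj Oq hq); have := growth y p (conj Op hp).
rewrite -/p -/q => gy gx.
have [->|pq] := eqVneq p q; first by rewrite subrr normr0 mulr_ge0.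
have pq0 : 0 < `|p - q| by rewrite normr_gt0 subr_eq0.
rewrite -(ler_pM2l pq0) -expr2.
have := le_trans (ler_norm _) (ip_le_norm ip_norm (p - q) (x - y)).
have : `|x - q| ^+ 2 + `|y - p| ^+ 2 - `|x - p| ^+ 2 - `|y - q| ^+ 2 =
    2 * ip (p - q) (x - y).
  rewrite -!(ipE ip_norm) !(ip_lin ip).
  by rewrite (ipC ip p x) (ipC ip p y) (ipC ip q x) (ipC ip q y); ring.
by move: gx gy; rewrite (distrC q p); lra.
Qed.

End prox.

(** * Euler polygons *)

Section prod_complete.
Context {R : realType} {U V : completeNormedModType R}.

HB.instance Definition _ := Pointed.on (U * V)%type.

(** Both projections of a Cauchy filter are Cauchy. This makes the phase space [H * H * H] complete,
    so that Euler polygons can converge in it. *)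
Lemma prod_complete (F : set_system (U * V)%type) :
  ProperFilter F -> cauchy F -> cvg F.
Proof.
move=> FF /cauchyP Fc.
have /cauchy_cvg /cvg_ex[/= u uP] : cauchy (fst @ F).
  apply/cauchyP => e e0; have [x xF] := Fc _ e0.
  by exists x.1; apply: (@filterS _ F _ (ball x e)) xF => y [].
have /cauchy_cvg /cvg_ex[/= v vP] : cauchy (snd @ F).
  apply/cauchyP => e e0; have [x xF] := Fc _ e0.
  by exists x.2; apply: (@filterS _ F _ (ball x e)) xF => y [].
apply/cvg_ex; exists (u, v).
apply: cvg_trans (cvg_pair uP vP).
by move=> A; apply: (@filterS _ F) => -[].
Qed.

HB.instance Definition _ := Uniform_isComplete.Build (U * V)%type prod_complete.
End prod_complete.

Section euler.
Context {R : realType} {X : completeNormedModType R}.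
Variables (Phi : X -> X) (K : R).
Hypothesis K_ge0 : 0 <= K.
Hypothesis Phi_lip : forall x y, `|Phi x - Phi y| <= K * `|x - y|.

Definition euler_step (h : R) (x : X) : X := x + h *: Phi x.

Lemma euler_step_norm h x : 0 <= h -> `|euler_step h x - x| = h * `|Phi x|.
Proof. by move=> h0; rewrite /euler_step addrC addKr normrZ ger0_norm. Qed.

Lemma Phi_euler_step h x : 0 <= h ->
  `|Phi (euler_step h x)| <= (1 + h * K) * `|Phi x|.
Proof.
move=> h0; rewrite -[Phi (euler_step h x)](subrK (Phi x)).
rewrite (le_trans (ler_normD _ _))// mulrDl mul1r addrC lerD2l.
rewrite (le_trans (Phi_lip _ _))// euler_step_norm//.
by rewrite mulrA (mulrC K).
Qed.

Lemma Phi_euler_iter h x k : 0 <= h ->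
  `|Phi (iter k (euler_step h) x)| <= (1 + h * K) ^+ k * `|Phi x|.
Proof.
move=> h0; elim: k => [|k IH]; first by rewrite expr0 mul1r.
rewrite iterS (le_trans (Phi_euler_step _ h0))// exprS -mulrA.
by rewrite ler_wpM2l// addr_ge0// mulr_ge0.
Qed.

Lemma euler_step_lip h x y : 0 <= h ->
  `|euler_step h x - euler_step h y| <= (1 + h * K) * `|x - y|.
Proof.
move=> h0; rewrite /euler_step opprD addrACA -scalerBr.
rewrite (le_trans (ler_normD _ _))// mulrDl mul1r lerD2l normrZ ger0_norm//.
by rewrite -mulrA ler_wpM2l.
Qed.

(** Local error of step halving: the two sides differ only in the point where the second half
    evaluates [Phi], and these points are [h |Phi x|] apart. *)
Lemma euler_halve h x : 0 <= h ->
  `|euler_step h (euler_step h x) - euler_step (2 * h) x| <=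
  K * h ^+ 2 * `|Phi x|.
Proof.
move=> h0.
have -> : euler_step h (euler_step h x) - euler_step (2 * h) x =
    h *: (Phi (euler_step h x) - Phi x).
  rewrite [in LHS]/euler_step -/(euler_step h x) mulr_natl mulr2n scalerDl.
  by rewrite scalerBr addrA opprD addrACA subrr add0r.
rewrite normrZ ger0_norm// expr2 mulrA -!mulrA mulrCA ler_wpM2l//.
by rewrite (le_trans (Phi_lip _ _))// euler_step_norm.
Qed.

(** Global error: the [k] local errors of [euler_halve], each amplified by the Lipschitz constants
    of the later steps. *)
Lemma euler_halve_iter h x k : 0 <= h ->
  `|iter (2 * k) (euler_step h) x - iter k (euler_step (2 * h)) x| <=
  k%:R * (K * h ^+ 2) * (1 + h * K) ^+ (2 * k) * `|Phi x|.
Proof.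
move=> h0; have hK0 : 0 <= h * K by rewrite mulr_ge0.
have q1 : 1 <= 1 + h * K by rewrite lerDl.
elim: k => [|k IH]; first by rewrite muln0 /= subrr normr0 !mul0r.
rewrite mulnS iterD [iter k.+1 _ _]iterS.
set a := iter (2 * k) _ x in IH *; set b := iter k _ x in IH *.
have -> : iter 2 (euler_step h) a = euler_step h (euler_step h a) by [].
(* Two fine steps from the coarse point [b] are inserted: one difference propagates the accumulated
   error, the other is a fresh local error. *)
rewrite -(subrKA (euler_step h (euler_step h b))).
rewrite (le_trans (ler_normD _ _))//.
(* The coarse growth factor [1 + 2 h K] is at most [(1 + h K)^2]. *)
have hb : `|Phi b| <= (1 + h * K) ^+ (2 * k) * `|Phi x|.
  rewrite (le_trans (Phi_euler_iter _ _ _)) ?mulr_ge0// ler_wpM2r//.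
  rewrite exprM lerXn2r ?nnegrE ?exprn_ge0// ?addr_ge0 ?mulr_ge0//.
  by have := sqr_ge0 (h * K); nra.
have h1 : `|euler_step h (euler_step h a) - euler_step h (euler_step h b)| <=
    (1 + h * K) ^+ 2 * (k%:R * (K * h ^+ 2) * (1 + h * K) ^+ (2 * k) * `|Phi x|).
  rewrite (le_trans (euler_step_lip _ _ _))// expr2 -mulrA.
  rewrite ler_wpM2l ?addr_ge0// (le_trans (euler_step_lip _ _ _))//.
  by rewrite ler_wpM2l ?addr_ge0.
have h2 : `|euler_step h (euler_step h b) - euler_step (2 * h) b| <=
    (1 + h * K) ^+ 2 * (K * h ^+ 2 * ((1 + h * K) ^+ (2 * k) * `|Phi x|)).
  rewrite (le_trans (euler_halve _ _))//.
  rewrite (le_trans (ler_wpM2l _ hb)) ?mulr_ge0 ?exprn_ge0//.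
  by rewrite ler_peMl ?mulr_ge0 ?exprn_ge0 ?addr_ge0 ?mulr_ge0// exprn_ege1.
rewrite (le_trans (lerD h1 h2))// exprD -natr1.
by rewrite le_eqVlt; apply/orP; left; apply/eqP; ring.
Qed.

Lemma euler_iter_dist h y m B : 0 <= h ->
  (forall j, (j < m)%N -> `|Phi (iter j (euler_step h) y)| <= B) ->
  `|iter m (euler_step h) y - y| <= h * m%:R * B.
Proof.
move=> h0; elim: m => [|m IH] hB; first by rewrite /= subrr normr0 mulr0 mul0r.
rewrite iterS -(subrKA (iter m (euler_step h) y)).
rewrite (le_trans (ler_normD _ _))// euler_step_norm// -natr1 mulrDr mulrDl.
rewrite mulr1 addrC lerD//.
  by apply: IH => j /ltnW; apply: hB.
by rewrite ler_wpM2l// hB.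
Qed.

(** The polygon leaves its initial tangent only as [Phi] varies, by at most [K h j B] at step [j].
    The sum over [j < m] is bounded through the elapsed time [h m] alone, so the estimate survives
    refinement. *)
Lemma euler_iter_taylor h y m B : 0 <= h -> 0 <= B ->
  (forall j, (j < m)%N -> `|Phi (iter j (euler_step h) y)| <= B) ->
  `|iter m (euler_step h) y - y - (h * m%:R) *: Phi y| <=
  K * B * (h * m%:R) ^+ 2.
Proof.
move=> h0 B0; elim: m => [|m IH] hB.
  by rewrite /= mulr0 scale0r !subrr normr0 expr0n mulr0.
have hB' j : (j < m)%N -> `|Phi (iter j (euler_step h) y)| <= B.
  by move=> /ltnW; apply: hB.
have {}IH := IH hB'; have Lm := euler_iter_dist h0 hB'.
rewrite iterS; set z := iter m _ y in IH Lm *.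
have -> : euler_step h z - y - (h * m.+1%:R) *: Phi y =
    (z - y - (h * m%:R) *: Phi y) + h *: (Phi z - Phi y).
  rewrite /euler_step -natr1 mulrDr mulr1 scalerDl scalerBr.
  rewrite opprD !addrA; congr (_ - _); rewrite -!addrA; congr (_ + _).
  by rewrite addrC !addrA.
rewrite (le_trans (ler_normD _ _))//.
have h1 : `|h *: (Phi z - Phi y)| <= h * (K * (h * m%:R * B)).
  rewrite normrZ ger0_norm// ler_wpM2l// (le_trans (Phi_lip _ _))//.
  by rewrite ler_wpM2l.
rewrite (le_trans (lerD IH h1))// -natr1 -subr_ge0.
have -> : K * B * (h * (m%:R + 1)) ^+ 2 -
    (K * B * (h * m%:R) ^+ 2 + h * (K * (h * m%:R * B))) =
    K * B * h ^+ 2 * (m%:R + 1) by ring.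
by rewrite !mulr_ge0// exprn_ge0.
Qed.

End euler.

(** * Convergence of the dyadic Euler scheme *)

Section euler_limit.
Context {R : realType} {X : completeNormedModType R}.
Variables (Phi : X -> X) (K : R).
Hypothesis K_ge0 : 0 <= K.
Hypothesis Phi_lip : forall x y, `|Phi x - Phi y| <= K * `|x - y|.
Variable x : X.

Let h n : R := 2^-1 ^+ n.

Let h_gt0 n : 0 < h n. Proof. by rewrite exprn_gt0. Qed.

Let h_cvg : h n @[n --> \oo] --> 0.
Proof. by apply: cvg_expr; rewrite ger0_norm// invf_lt1 ?ltr1n. Qed.

Let steps n (t : R) : nat := Num.truncn (t / h n).

Let steps_itv n t : 0 <= t ->
  h n * (steps n t)%:R <= t < h n * (steps n t)%:R + h n.
Proof.
move=> t0; rewrite /steps; have := truncn_itv (divr_ge0 t0 (ltW (h_gt0 n))).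
by rewrite ler_pdivlMr// ltr_pdivrMr// -natr1 mulrDl mul1r !(mulrC (h n)).
Qed.

Let steps_le n s t : s <= t -> (steps n s <= steps n t)%N.
Proof. by move=> st; rewrite le_truncn// ler_pM2r ?invr_gt0. Qed.

(** The scheme is piecewise constant in [t] rather than interpolated: its jumps vanish with [h n],
    and elapsed times stay whole numbers of steps. *)
Let u n t := iter (steps n t) (euler_step Phi (h n)) x.

(** Speed bound up to time [T], uniform in the step size because [1 + a K <= exp (a K)]. *)
Let M (T : R) := expR (K * T) * `|Phi x|.

Let M_ge0 T : 0 <= M T. Proof. by rewrite mulr_ge0// expR_ge0. Qed.

Let growth_le (a T : R) j : 0 <= a -> a * j%:R <= T ->
  (1 + a * K) ^+ j <= expR (K * T).
Proof.
move=> a0 ajT.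
rewrite (@le_trans _ _ (expR (a * K) ^+ j))//.
  rewrite lerXn2r ?nnegrE ?expR_ge0 ?addr_ge0 ?mulr_ge0//.
  exact: expR_ge1Dx.
rewrite -expRM_natr ler_expR (mulrC a) -mulrA.
exact: ler_wpM2l.
Qed.

Let speed_le (a T : R) j : 0 <= a -> a * j%:R <= T ->
  `|Phi (iter j (euler_step Phi a) x)| <= M T.
Proof.
move=> a0 ajT; rewrite (le_trans (Phi_euler_iter K_ge0 Phi_lip _ _ a0))//.
by rewrite ler_wpM2r// growth_le.
Qed.

Let speed_step n s t T k : 0 <= s -> s <= t -> t <= T ->
  (k < steps n t - steps n s)%N ->
  `|Phi (iter k (euler_step Phi (h n)) (u n s))| <= M T.
Proof.
move=> s0 st tT kst; rewrite /u -iterD speed_le ?(ltW (h_gt0 _))//.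
rewrite (le_trans _ tT)//.
have /andP[+ _] := steps_itv n (le_trans s0 st).
apply: le_trans; rewrite ler_pM2l// ler_nat.
by move: kst; rewrite ltn_subRL addnC => /ltnW.
Qed.

Let u_dist n s t T : 0 <= s -> s <= t -> t <= T ->
  `|u n t - u n s| <= h n * (steps n t - steps n s)%:R * M T.
Proof.
move=> s0 st tT.
rewrite [u n t](_ : _ =
    iter (steps n t - steps n s) (euler_step Phi (h n)) (u n s)).
  apply: euler_iter_dist; first exact: ltW.
  by move=> j; exact: speed_step.
by rewrite /u -iterD subnK// steps_le.
Qed.

Let u_taylor n s t T : 0 <= s -> s <= t -> t <= T ->
  let d := h n * (steps n t - steps n s)%:R in
  `|u n t - u n s - d *: Phi (u n s)| <= K * M T * d ^+ 2.
Proof.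
move=> s0 st tT.
rewrite [u n t](_ : _ =
    iter (steps n t - steps n s) (euler_step Phi (h n)) (u n s)).
  apply: euler_iter_taylor => //; first exact: ltW.
  by move=> j; exact: speed_step.
by rewrite /u -iterD subnK// steps_le.
Qed.

(** The summand [K * T] comes from halving the steps over a common time, the [+ 1] from a possible
    extra fine step. *)
Let u_cauchy1 n t T : 0 <= t -> t <= T ->
  `|u n.+1 t - u n t| <= ((K * T + 1) * M T) * h n.
Proof.
move=> t0 tT.
have hE : h n = 2 * h n.+1 by rewrite /h exprS mulrA mulfV// mul1r.
set N := steps n t.
have /andP[N1 N2] := steps_itv n t0; rewrite -/N in N1 N2.
have h1 := h_gt0 n.+1.
have N2t : h n.+1 * (2 * N)%:R <= t by rewrite natrM; move: N1; rewrite hE; lra.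
have hv : `|iter (2 * N) (euler_step Phi (h n.+1)) x - u n t| <= K * T * M T * h n.
  rewrite /u -/N hE (le_trans (euler_halve_iter K_ge0 Phi_lip _ _ (ltW h1)))//.
  rewrite [leLHS](_ : _ = (K * h n.+1 * (1 + h n.+1 * K) ^+ (2 * N) * `|Phi x|) *
    (h n.+1 * N%:R)); last by ring.
  rewrite [leRHS](_ : _ = (K * h n.+1 * expR (K * T) * `|Phi x|) * (2 * T));
    last by rewrite /M; ring.
  apply: ler_pM => //.
  - by rewrite !mulr_ge0 ?exprn_ge0 ?addr_ge0 ?mulr_ge0// ltW.
  - by rewrite mulr_ge0// ltW.
  - rewrite ler_wpM2r// ler_wpM2l ?mulr_ge0 ?(ltW h1)//.
    by apply: growth_le; [exact: ltW|exact: le_trans tT].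
  - by move: N2t; rewrite natrM; lra.
(* The fine step count is twice the coarse one, plus one when [t] lies in the second half of its
   coarse step. *)
have [E|E] : steps n.+1 t = (2 * N)%N \/ steps n.+1 t = (2 * N).+1.
  have /andP[m1 m2] := steps_itv n.+1 t0; set m := steps n.+1 t in m1 m2 *.
  have : (2 * N < m.+1)%N.
    rewrite -(ltr_nat R) -(ltr_pM2l h1) -[m.+1%:R]natr1.
    by rewrite (le_lt_trans N2t)//; lra.
  have : (m < (2 * N).+2)%N.
    rewrite -(ltr_nat R) -(ltr_pM2l h1).
    rewrite -[(2 * N).+2%:R]natr1 -[(2 * N).+1%:R]natr1 natrM.
    by rewrite (le_lt_trans m1)//; move: N2; rewrite hE; lra.
  rewrite !ltnS leq_eqVlt => /orP[/eqP|]; first by right.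
  by rewrite ltnS => a b; left; apply/eqP; rewrite eqn_leq a b.
  rewrite [u n.+1 t]/u E (le_trans hv)// ler_wpM2r ?(ltW (h_gt0 _))//.
  by rewrite ler_wpM2r// lerDl.
rewrite [u n.+1 t]/u E iterS -(subrKA (iter (2 * N) (euler_step Phi (h n.+1)) x)).
rewrite (le_trans (ler_normD _ _))// euler_step_norm ?(ltW h1)//.
rewrite addrC (mulrDl _ 1) mul1r mulrDl lerD//.
rewrite mulrC ler_pM ?(ltW h1)//.
  by apply: speed_le; [exact: ltW|exact: le_trans tT].
by rewrite hE ler_peMl ?ltW// ltr1n.
Qed.

Let u_cauchy n m t T : 0 <= t -> t <= T -> (n <= m)%N ->
  `|u n t - u m t| <= ((K * T + 1) * M T) * (2 * h n).
Proof.
move=> t0 tT; set C := _ * M T.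
have C0 : 0 <= C by rewrite mulr_ge0// addr_ge0// mulr_ge0// (le_trans t0).
(* [2 h n - 2 h (d + n)] is exactly the geometric sum of [h n] up to [h (d + n - 1)], so the
   induction closes. *)
suff main d : `|u n t - u (d + n)%N t| <= C * (2 * h n - 2 * h (d + n)%N).
  move=> /subnK <-; rewrite (le_trans (main _))// ler_wpM2l// gerBl.
  by rewrite mulr_ge0// ltW.
elim: d => [|d IH]; first by rewrite add0n !subrr normr0 mulr0.
rewrite -(subrKA (u (d + n)%N t)) (le_trans (ler_normD _ _))//.
have := u_cauchy1 (d + n)%N t0 tT; rewrite distrC -/C => h1.
rewrite (le_trans (lerD IH h1))// -mulrDr ler_wpM2l//.
have -> : h (d + n)%N = 2 * h (d.+1 + n)%N by rewrite /h exprS mulrA mulfV// mul1r.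
by lra.
Qed.

Let v t := lim (u n t @[n --> \oo]).

Let v_cvg t : 0 <= t -> u n t @[n --> \oo] --> v t.
Proof.
move=> t0.
apply: (@cauchy_modulus_cvg _ _ _ (fun n => (K * t + 1) * M t * (2 * h n))).
  by move=> n m nm; exact: u_cauchy.
rewrite -[X in _ --> X](mulr0 ((K * t + 1) * M t)); apply: cvgMr.
by rewrite -[X in _ --> X](mulr0 2); apply: cvgMr.
Qed.

Let d_cvg s t : 0 <= s -> s <= t ->
  h n * (steps n t - steps n s)%:R @[n --> \oo] --> t - s.
Proof.
move=> s0 st; apply/cvgrPdist_le => e e0.
near=> n.
have /andP[a1 a2] := steps_itv n s0.
have /andP[b1 b2] := steps_itv n (le_trans s0 st).
have hn : h n <= e.
  near: n; have /cvgrPdist_le/(_ e e0) := h_cvg.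
  by apply: filterS => n; rewrite sub0r normrN ger0_norm// ltW.
rewrite natrB ?steps_le// mulrBr ler_norml; apply/andP; split; lra.
Unshelve. all: by end_near. Qed.

Let Phi_cvg (w : nat -> X) y : w n @[n --> \oo] --> y ->
  Phi (w n) @[n --> \oo] --> Phi y.
Proof.
move=> wy; apply/cvgrPdistC_le => e e0.
have K1 : 0 < K + 1 by rewrite ltr_wpDl.
move/cvgrPdistC_le : wy => /(_ _ (divr_gt0 e0 K1)); apply: filterS => n.
rewrite ler_pdivlMr// => wn.
rewrite (le_trans (Phi_lip _ _))// (le_trans _ wn)// mulrC ler_wpM2l//.
by rewrite lerDl.
Qed.

(* The limit of the Euler polygons with steps [2 ^- n]; the quadratic error
   bound makes it differentiable. *)
Lemma lipschitz_flow : exists2 w : R -> X, w 0 = x &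
  forall T, exists2 C, 0 <= C & forall s t, 0 <= s -> s <= t -> t <= T ->
    `|w t - w s| <= C * (t - s) /\
    `|w t - w s - (t - s) *: Phi (w s)| <= C * (t - s) ^+ 2.
Proof.
exists v.
  apply/cvg_lim => //; have -> : (fun n => u n 0) = cst x; last exact: cvg_cst.
  by apply/funext => n; rewrite /u /steps mul0r truncn0.
move=> T; exists ((K + 1) * M T); first by rewrite mulr_ge0// addr_ge0.
move=> s t s0 st tT; have t0 := le_trans s0 st.
have vt := v_cvg t0; have vs := v_cvg s0; have dc := d_cvg s0 st.
have KM : M T <= (K + 1) * M T by rewrite ler_peMl// lerDr.
have KM' : K * M T <= (K + 1) * M T by rewrite ler_wpM2r// lerDl.
split.
  rewrite (@le_trans _ _ ((t - s) * M T))//; last first.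
    by rewrite mulrC ler_wpM2r// subr_ge0.
  apply: (ler_cvg_to (cvg_norm (cvgB vt vs)) (cvgMl dc)).
  by apply: nearW => n /=; exact: u_dist.
rewrite (@le_trans _ _ (K * M T * (t - s) ^+ 2))//; last first.
  by rewrite ler_wpM2r// sqr_ge0.
have c1 := cvg_norm (cvgB (cvgB vt vs) (cvgZ dc (Phi_cvg vs))).
have c2 := cvgMr (a := K * M T) (cvgM dc dc).
rewrite expr2; apply: (ler_cvg_to (c1 _ _ _ _) (c2 _ _)).
by apply: nearW => n /=; have := u_taylor n s0 st tT; rewrite -expr2.
Qed.

End euler_limit.

(** * Bochner density of a Lipschitz curve *)

Lemma big_nat_mul (V : nmodType) (F : nat -> V) (a c : nat) :
  \sum_(0 <= j < a * c) F j =
  \sum_(0 <= i < a) \sum_(0 <= l < c) F (i * c + l)%N.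
Proof.
elim: a => [|a IH]; first by rewrite mul0n !big_geq.
rewrite big_nat_recr//= -IH mulSnr (@big_cat_nat _ _ _ (a * c)) ?leq_addr//=.
congr (_ + _); rewrite -{1}[(a * c)%N]add0n big_addn addKn.
by apply: eq_bigr => i _; rewrite addnC.
Qed.

Section dyadic.
Context {R : realType} {H : completeNormedModType R} (ip : {dot H for idfun}).
Hypothesis ip_norm : induces_norm ip.
Variables (s0 s1 L : R) (b : R -> H).
Hypotheses (s01 : s0 < s1) (L_ge0 : 0 <= L).
Hypothesis b_lip : forall s t, s0 <= s -> s <= t -> t <= s1 ->
  `|b t - b s| <= L * (t - s).

Definition mesh n : R := (s1 - s0) * 2^-1 ^+ n.
Definition node n i : R := s0 + mesh n * i%:R.
Definition slope n i : H := (mesh n)^-1 *: (b (node n i.+1) - b (node n i)).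
(** The squared L^2 norm on [[s0, s1[] of the step function with values [slope n i]. *)
Definition energy n : R := \sum_(0 <= i < 2 ^ n) mesh n * `|slope n i| ^+ 2.

Lemma mesh_gt0 n : 0 < mesh n.
Proof. by rewrite mulr_gt0 ?subr_gt0// exprn_gt0. Qed.

Lemma mesh_node n i : mesh n *: slope n i = b (node n i.+1) - b (node n i).
Proof. by rewrite scalerA mulfV ?scale1r// gt_eqF// mesh_gt0. Qed.

Lemma mesh_refine d n : mesh n = mesh (d + n) * (2 ^ d)%:R.
Proof.
rewrite /mesh exprD -mulrA; congr (_ * _).
by rewrite mulrAC natrX -exprMn mulVf ?expr1n ?mul1r// pnatr_eq0.
Qed.

Lemma mesh_total n : mesh n * (2 ^ n)%:R = s1 - s0.
Proof. by have := mesh_refine n 0; rewrite addn0 => <-; rewrite /mesh mulr1. Qed.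

Lemma node_refine d n i : node (d + n) (i * 2 ^ d) = node n i.
Proof. by rewrite /node (mesh_refine d n) natrM; congr (_ + _); ring. Qed.

Lemma node0 n : node n 0 = s0.
Proof. by rewrite /node mulr0 addr0. Qed.

Lemma node_last n : node n (2 ^ n) = s1.
Proof. by rewrite /node mesh_total addrC subrK. Qed.

Lemma nodeS n i : node n i.+1 = node n i + mesh n.
Proof. by rewrite /node -natr1; ring. Qed.

Lemma node_le n i j : (i <= j)%N -> node n i <= node n j.
Proof. by move=> ij; rewrite lerD2l ler_pM2l ?mesh_gt0// ler_nat. Qed.

Lemma slope_le n i : (i < 2 ^ n)%N -> `|slope n i| <= L.
Proof.
move=> i2; have m0 := mesh_gt0 n.
rewrite normrZ gtr0_norm ?invr_gt0// mulrC ler_pdivrMr//.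
rewrite (le_trans (b_lip _ _ _)) ?node_le//.
- by rewrite -(node0 n) node_le.
- by rewrite -(node_last n) node_le.
by rewrite nodeS addrAC subrr add0r.
Qed.

Lemma energy_le n : energy n <= L ^+ 2 * (s1 - s0).
Proof.
have -> : L ^+ 2 * (s1 - s0) = \sum_(0 <= i < 2 ^ n) mesh n * L ^+ 2.
  by rewrite big_const_nat subn0 iter_addr addr0 -mulr_natr -(mesh_total n); ring.
rewrite /energy !big_mkord ler_sum// => i _.
by rewrite ler_wpM2l ?(ltW (mesh_gt0 n))// lerXn2r ?nnegrE// slope_le.
Qed.

(* The coarse slope is the mean of the finer ones, so the slopes form a
   martingale with orthogonal increments. *)
Lemma energy_increment d n :
  \sum_(0 <= j < 2 ^ (d + n))
     mesh (d + n) * `|slope (d + n) j - slope n (j %/ 2 ^ d)| ^+ 2 =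
  energy (d + n) - energy n.
Proof.
rewrite /energy.
have -> : (2 ^ (d + n) = 2 ^ n * 2 ^ d)%N by rewrite expnD mulnC.
rewrite !big_nat_mul -sumrB; apply: eq_big_nat => i _.
set m := (d + n)%N; set c := slope n i.
have telescope :
    \sum_(0 <= l < 2 ^ d) mesh m *: slope m (i * 2 ^ d + l) = mesh n *: c.
  rewrite mesh_node -(node_refine d n i.+1) -(node_refine d n i) mulSnr.
  have := telescope_sumr (fun l => b (node m (i * 2 ^ d + l))) (leq0n (2 ^ d)).
  rewrite /= addn0 => <-.
  by apply: eq_bigr => l _; rewrite mesh_node addnS.
(* The finer slopes average to [c], so the cross terms sum to [2 mesh n |c|^2]; removing
   [mesh n |c|^2] leaves the coarse energy. *)
rewrite (_ : mesh n * `|c| ^+ 2 =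
    \sum_(0 <= l < 2 ^ d)
      mesh m * (2 * ip (slope m (i * 2 ^ d + l)) c - `|c| ^+ 2)).
  rewrite -sumrB; apply: eq_big_nat => l /andP[_ l2].
  rewrite divnMDl ?expn_gt0// divn_small// addn0 (normB_sqr ip_norm) -/c.
  by ring.
under eq_bigr do rewrite mulrBr mulrCA -(ipZl ip (mesh m)).
rewrite sumrB -mulr_sumr; have ip0 : ip 0 c = 0 by rewrite linear0l.
rewrite -(big_morph (fun u => ip u c) (fun u v => ipDl ip u v c) ip0).
rewrite telescope ipZl (ipE ip_norm) big_const_nat subn0 iter_addr addr0.
by rewrite -mulr_natr (mesh_refine d n); ring.
Qed.

Lemma energy_mono n m : (n <= m)%N -> energy n <= energy m.
Proof.
move=> /subnK <-; rewrite -subr_ge0 -energy_increment sumr_ge0// => i _.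
by rewrite mulr_ge0 ?sqr_ge0// ltW// mesh_gt0.
Qed.

(** From L^2 to L^1 by the pointwise bound [y <= e + y^2 / e]: the first term contributes
    [e * (s1 - s0)], the second at most [e]. *)
Lemma slope_increment d n (e : R) : 0 < e -> energy (d + n) - energy n <= e ^+ 2 ->
  \sum_(0 <= j < 2 ^ (d + n))
     mesh (d + n) * `|slope (d + n) j - slope n (j %/ 2 ^ d)| <=
  e * (s1 - s0 + 1).
Proof.
move=> e0 he; rewrite -energy_increment in he.
have am y : y <= e + y ^+ 2 / e :> R.
  rewrite -(ler_pM2r e0) mulrDl mulfVK ?gt_eqF//.
  by have := sqr_ge0 (y - e); nra.
rewrite (@le_trans _ _ (\sum_(0 <= j < 2 ^ (d + n)) (mesh (d + n) * e +
    mesh (d + n) * `|slope (d + n) j - slope n (j %/ 2 ^ d)| ^+ 2 / e)))//.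
  rewrite !big_mkord ler_sum// => j _.
  by rewrite -mulrA -mulrDr ler_wpM2l ?am// ltW// mesh_gt0.
rewrite big_split/= big_const_nat subn0 iter_addr addr0 -mulr_natr mulrAC mesh_total.
by rewrite -mulr_suml mulrDr mulr1 (mulrC e) lerD2l ler_pdivrMr//.
Qed.

Lemma energy_subsequence : exists N : nat -> nat,
  [/\ {homo N : k l / (k <= l)%N}, forall k, (k <= N k)%N &
      forall k, energy (N k.+1) - energy (N k) <= (2^-1 ^+ k) ^+ 2].
Proof.
have hs : has_sup (range energy).
  split; first by exists (energy 0), 0%N.
  by exists (L ^+ 2 * (s1 - s0)) => _ [n _ <-]; exact: energy_le.
have /choice[g gP] : forall k, exists n,
    sup (range energy) - (2^-1 ^+ k) ^+ 2 < energy n.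
  move=> k; have e0 : 0 < (2^-1 ^+ k) ^+ 2 :> R by rewrite !exprn_gt0.
  by have [_ [n _ <-] hn] := sup_adherent e0 hs; exists n.
(* Summing the successors makes [N] monotone and at least both [g k] and [k]; the latter forces the
   meshes to 0. *)
pose N k := (\sum_(0 <= i < k.+1) (g i).+1)%N.
have NS k : N k.+1 = (N k + (g k.+1).+1)%N by rewrite /N big_nat_recr.
have Nmono : {homo N : k l / (k <= l)%N}.
  by apply: homo_leq => //; [exact: leq_trans|move=> k; rewrite NS leq_addr].
have gN k : (g k <= N k)%N.
  case: k => [|k]; last by rewrite NS addnS ltnW// ltnS leq_addl.
  by rewrite /N big_nat1.
exists N; split=> //.
  by elim=> // k IH; rewrite NS addnS ltnS (leq_trans IH)// leq_addr.
move=> k; rewrite lerBlDr -lerBlDl.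
rewrite (le_trans _ (energy_mono (gN k)))// (le_trans _ (ltW (gP k)))//.
rewrite lerD2r; apply: ub_le_sup; first by case: hs.
by exists (N k.+1).
Qed.

End dyadic.

(** The integral of a nonnegative function is a supremum over the simple functions below it, so no
    measurability is asked for. This serves for norms of [H]-valued functions, whose measurability
    is not established. *)
Lemma ge0_integral_mono d (T : measurableType d) (R : realType)
    (mu : {measure set T -> \bar R}) (A B : set T) (f g : T -> \bar R) :
  A `<=` B -> (forall x, A x -> (0 <= f x)%E) -> (forall x, B x -> (0 <= g x)%E) ->
  (forall x, A x -> (f x <= g x)%E) ->
  (\int[mu]_(x in A) f x <= \int[mu]_(x in B) g x)%E.
Proof.
move=> AB f0 g0 fg; rewrite !ge0_integralE//.
apply: le_ereal_sup => _ [k kf <-]; exists k => // x.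
apply: le_trans (kf x) _; rewrite /patch.
case: ifPn => [/set_mem Ax|_]; first by rewrite (mem_set (AB _ Ax)) fg.
by case: ifPn => // /set_mem; exact: g0.
Qed.

(** Absolute convergence of the telescoping series; applied to a shifted sequence, the bound on the
    limit is an error estimate from any index. *)
Lemma summable_increments_cvg (R : realType) (H : completeNormedModType R)
    (a : nat -> H) (B : R) :
  (forall j, \sum_(0 <= k < j) `|a k.+1 - a k| <= B) ->
  exists2 l, a n @[n --> \oo] --> l & `|l - a 0%N| <= B.
Proof.
move=> aB; pose u k := a k.+1 - a k.
have su n : series u n = a n - a 0%N by rewrite /series/= telescope_sumr.
have /cvg_ex[/= s us] : cvg (series u n @[n --> \oo]).
  apply: normed_cvg; apply: nondecreasing_is_cvgn.
    by apply/nondecreasing_seqP => n; rewrite [leRHS]big_nat_recr//= lerDl.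
  by exists B => _ [n _ <-]; exact: aB.
have al : a n @[n --> \oo] --> s + a 0%N.
  have : series u n + a 0%N @[n --> \oo] --> s + a 0%N.
    by apply: cvgD => //; exact: cvg_cst.
  by under eq_fun do rewrite su subrK.
exists (s + a 0%N) => //.
have lim_norm : `|a n - a 0%N| @[n --> \oo] --> `|s + a 0%N - a 0%N|.
  by apply: cvg_norm; apply: cvgB => //; exact: cvg_cst.
apply: (ler_cvg_to lim_norm (cvg_cst B)).
apply: nearW => n /=; rewrite -(telescope_sumr a (leq0n n)).
exact: le_trans (ler_norm_sum _ _ _) (aB n).
Qed.

(** * The limit of the dyadic slopes as a Bochner density *)

Section dyadic_density.
Context {R : realType} {H : completeNormedModType R} (ip : {dot H for idfun}).
Hypothesis ip_norm : induces_norm ip.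
Variables (s0 s1 L : R) (b : R -> H).
Hypotheses (s01 : s0 < s1) (L_ge0 : 0 <= L).
Hypothesis b_lip : forall s t, s0 <= s -> s <= t -> t <= s1 ->
  `|b t - b s| <= L * (t - s).

Local Notation mu := (@lebesgue_measure R).
Local Notation mesh := (mesh s0 s1).
Local Notation node := (node s0 s1).
Local Notation slope := (slope s0 s1 b).
Local Notation energy := (energy s0 s1 b).

Definition cell n i : set R := `[node n i, node n i.+1[%classic.

Definition dyadic_slopes n : seq (set R * H) :=
  [seq (cell n i, slope n i) | i <- index_iota 0 (2 ^ n)].

Lemma measurable_cell n i : measurable (cell n i).
Proof. exact: measurable_itv. Qed.

Lemma cell_ex n x : s0 <= x -> x < s1 -> exists2 i, (i < 2 ^ n)%N & cell n i x.
Proof.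
move=> s0x xs1; have m0 := mesh_gt0 s01 n.
have y0 : 0 <= (x - s0) / mesh n by rewrite divr_ge0 ?subr_ge0// ltW.
have := truncn_itv y0; set i := Num.truncn _.
rewrite ler_pdivlMr// ltr_pdivrMr// => /andP[i1 i2].
exists i.
  rewrite -(ltr_nat R) -(ltr_pM2r m0) (le_lt_trans i1)// mulrC mesh_total.
  by rewrite ltrBlDr subrK.
by rewrite /cell/= in_itv/= /node !(mulrC (mesh n)) -lerBrDl i1/= -ltrBlDl.
Qed.

Lemma cell_inj n i j x : cell n i x -> cell n j x -> i = j.
Proof.
wlog : i j / (i <= j)%N => [w|].
  by case/orP: (leq_total i j) => ij xi xj; [|symmetry]; exact: w.
rewrite leq_eqVlt => /orP[/eqP//|ij]; rewrite /cell/= !in_itv/=.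
move=> /andP[_ xi] /andP[xj _].
by have := lt_le_trans xi (le_trans (node_le s01 n ij) xj); rewrite ltxx.
Qed.

Lemma cell_coarse d n j x : cell (d + n) j x -> cell n (j %/ 2 ^ d) x.
Proof.
rewrite /cell/= !in_itv/=; set k := (j %/ 2 ^ d)%N.
rewrite -(node_refine s0 s1 d n k) -(node_refine s0 s1 d n k.+1) => /andP[jx xj].
apply/andP; split; [apply: le_trans jx|apply: (lt_le_trans xj)];
  apply: node_le => //.
  exact: leq_trunc_div.
by rewrite ltn_ceil// expn_gt0.
Qed.

Lemma sum_cell (V : lmodType R) (F : nat -> V) n i x : (i < 2 ^ n)%N ->
  cell n i x -> \sum_(0 <= j < 2 ^ n) (\1_(cell n j) x : R) *: F j = F i.
Proof.
move=> i2 xi; rewrite big_mkord (bigD1 (Ordinal i2))//= big1 => [|j ji].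
  by rewrite indicE mem_set// scale1r addr0.
rewrite indicE memNset ?scale0r// => xj.
by move/eqP: ji; apply; apply: val_inj; exact: cell_inj xj xi.
Qed.

Lemma eval_cell n i x : (i < 2 ^ n)%N -> cell n i x ->
  simple_eval (dyadic_slopes n) x = slope n i.
Proof.
by move=> i2 xi; rewrite /simple_eval big_map/= (sum_cell (slope n) i2 xi).
Qed.

Lemma mu_cell n i : mu (cell n i) = (mesh n)%:E.
Proof.
rewrite /cell lebesgue_measure_itv/= lte_fin nodeS ltrDl (mesh_gt0 s01)/=.
by rewrite -EFinD addrAC subrr add0r.
Qed.

Lemma dyadic_simple_on (D : set (measurableTypeR R)) n : measurable D ->
  simple_on mu D (dyadic_slopes n).
Proof.
move=> mD p /mapP[i _ ->]/=; split; first exact: measurable_cell.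
apply: le_lt_trans (_ : mu (cell n i) < +oo)%E; last by rewrite mu_cell ltry.
apply: le_measure; rewrite ?inE//; last exact: measurable_cell.
by apply: measurableI; [exact: mD|exact: measurable_cell].
Qed.

(** The distance between the step functions of levels [d + n] and [n], written with indicators so
    that measurability and integration go term by term. *)
Definition oscillation d n x : R := \sum_(0 <= j < 2 ^ (d + n))
  \1_(cell (d + n) j) x * `|slope (d + n) j - slope n (j %/ 2 ^ d)|.

Lemma oscillationE d n x : s0 <= x -> x < s1 ->
  `|simple_eval (dyadic_slopes (d + n)) x - simple_eval (dyadic_slopes n) x| =
  oscillation d n x.
Proof.
move=> s0x xs1; have [j j2 xj] := cell_ex (d + n) s0x xs1.
have xi := cell_coarse xj.
have i2 : (j %/ 2 ^ d < 2 ^ n)%N by rewrite ltn_divLR ?expn_gt0// -expnD addnC.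
rewrite (eval_cell j2 xj) (eval_cell i2 xi).
(* Viewing the reals as a module over themselves lets [sum_cell] apply to scalars too. *)
pose F j : R^o := `|slope (d + n) j - slope n (j %/ 2 ^ d)|.
exact/esym/(sum_cell F j2 xj).
Qed.

Lemma oscillation_ge0 d n x : 0 <= oscillation d n x.
Proof. by apply: sumr_ge0 => j _; rewrite mulr_ge0// indicE. Qed.

Lemma measurable_oscillation d n (D : set (measurableTypeR R)) :
  measurable_fun D (fun x => (oscillation d n x)%:E).
Proof.
apply/measurable_EFinP; rewrite /oscillation; apply: measurable_sum => j.
apply: measurable_funM => //; apply: measurable_indic.
exact: measurable_cell.
Qed.

Lemma integral_oscillation d n (e : R) : 0 < e ->
  energy (d + n) - energy n <= e ^+ 2 ->
  (\int[mu]_(x in `[s0, s1[) (oscillation d n x)%:E <= (e * (s1 - s0 + 1))%:E)%E.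
Proof.
move=> e0 he.
have := slope_increment ip_norm s01 e0 he; rewrite -lee_fin; apply: le_trans.
under eq_integral do rewrite /oscillation -sumEFin.
rewrite ge0_integral_sum//=; last first.
  move=> j; apply/measurable_EFinP; apply: measurable_funM => //.
  by apply: measurable_indic; exact: measurable_cell.
rewrite -sumEFin big_mkord [leRHS]big_mkord; apply: lee_sum => j _.
under eq_integral do rewrite EFinM.
rewrite ge0_integralZr//=; last first.
  by apply/measurable_EFinP; apply: measurable_indic; exact: measurable_cell.
rewrite integral_indic//; last exact: measurable_cell.
rewrite EFinM lee_wpmul2r ?lee_fin// -(mu_cell (d + n) j).
apply: le_measure; rewrite ?inE//; last exact: measurable_cell.
by apply: measurableI => //; exact: measurable_cell.
Qed.

(** The integral telescopes to increments of [b] over whole cells; only the cell cut by [t] leaves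
    an error, of the order of the mesh. *)
Lemma simple_integral_cvg (N : nat -> nat) t : (forall k, (k <= N k)%N) ->
  s0 <= t -> t <= s1 ->
  simple_integral mu `[s0, t[ (dyadic_slopes (N k)) @[k --> \oo] --> b t - b s0.
Proof.
move=> Nk s0t ts1.
(* Nodes clipped at [t]: cells beyond [t] get weight 0. *)
pose c n i := Num.min t (node n i).
have weight n i : fine (mu (`[s0, t[ `&` cell n i)) = c n i.+1 - c n i.
  have n0 : s0 <= node n i by have := node_le s01 n (leq0n i); rewrite node0.
  have -> : (`[s0, t[ `&` cell n i = `[node n i, c n i.+1[)%classic.
    apply/seteqP; split=> x; rewrite /cell /= !in_itv/= lt_min.
      by move=> [/andP[_ ->] /andP[-> ->]].
    by move=> /and3P[nx -> ->]; rewrite nx (le_trans n0).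
  have nn : node n i < node n i.+1 by rewrite nodeS ltrDl mesh_gt0.
  rewrite lebesgue_measure_itv/= lte_fin /c lt_min nn andbT.
  have [nt|tn] := ltP (node n i) t.
    by [].
  by rewrite (min_l (le_trans tn (ltW nn))) subrr.
have main n k : (k <= 2 ^ n)%N ->
    let S := \sum_(0 <= i < k) (c n i.+1 - c n i) *: slope n i in
    (node n k <= t -> S = b (node n k) - b s0) /\
    (t <= node n k -> `|S - (b t - b s0)| <= 2 * L * mesh n).
  have m0 := mesh_gt0 s01 n.
  elim: k => [_|k IH k2] S.
    rewrite /S big_geq// node0; split=> [_|ts0]; first by rewrite subrr.
    have -> : t = s0 by apply/eqP; rewrite eq_le ts0.
    by rewrite !subrr normr0 !mulr_ge0// subr_ge0 ltW.
  have [IH1 IH2] := IH (ltnW k2).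
  have nS : node n k <= node n k.+1 by exact: node_le.
  rewrite /S big_nat_recr//=; split=> [kt|tk].
    rewrite IH1 ?(le_trans nS)// /c (min_r kt) (min_r (le_trans nS kt)).
    have -> : node n k.+1 - node n k = mesh n by rewrite nodeS addrAC subrr add0r.
    by rewrite mesh_node// addrC addrA subrK.
  rewrite [c n k.+1]min_l//; have [tk'|kt] := leP t (node n k).
    by rewrite [c n k]min_l// subrr scale0r addr0 IH2.
  rewrite [c n k](min_r (ltW kt)) (IH1 (ltW kt)).
  (* In the cell containing [t], the missing increment of [b] and the linear part each cost at most
     [L * mesh n]. *)
  rewrite [X in `|X|](_ : _ =
      (b (node n k) - b t) + (t - node n k) *: slope n k); last first.
    by rewrite opprB addrAC addrA subrK addrAC.
  have kt0 : 0 <= t - node n k by rewrite subr_ge0 ltW.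
  have ktm : t - node n k <= mesh n by rewrite lerBlDl -nodeS.
  have s0k : s0 <= node n k by have := node_le s01 n (leq0n k); rewrite node0.
  rewrite (le_trans (ler_normD _ _))// normrZ (ger0_norm kt0) distrC.
  have h1 := b_lip s0k (ltW kt) ts1.
  have h2 := slope_le s01 b_lip k2.
  have := ler_wpM2l kt0 h2; have := ler_wpM2l L_ge0 ktm.
  by nra.
have bound k : `|simple_integral mu `[s0, t[ (dyadic_slopes (N k)) - (b t - b s0)|
    <= 2 * L * (s1 - s0) * 2^-1 ^+ k.
  rewrite /simple_integral big_map/=; under eq_bigr do rewrite weight.
  have [_] := main (N k) (2 ^ N k)%N (leqnn _).
  rewrite node_last// => /(_ ts1)/le_trans; apply.
  rewrite /mesh mulrA ler_wpM2l ?mulr_ge0 ?subr_ge0 ?(ltW s01)//.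
  by rewrite ler_wiXn2l// invf_le1 ?ler1n.
apply/cvgrPdistC_le => e e0.
have /cvgrPdistC_le/(_ e e0) : 2 * L * (s1 - s0) * 2^-1 ^+ k @[k --> \oo] --> 0.
  rewrite -[X in _ --> X](mulr0 (2 * L * (s1 - s0))); apply: cvgMr.
  by apply: cvg_expr; rewrite ger0_norm// invf_lt1 ?ltr1n.
apply: filterS => k; rewrite subr0 => /ler_normlW; exact: le_trans.
Qed.

Lemma lipschitz_density : exists z : R -> H,
  forall t, s0 <= t -> t <= s1 -> has_bochner_integral mu `[s0, t[ z (b t - b s0).
Proof.
have [N [Nmono Nk Ne]] := energy_subsequence ip_norm s01 L_ge0 b_lip.
pose a k := simple_eval (dyadic_slopes (N k)) : R -> H.
(* Where the slopes diverge, [lim] is a default value; this happens only on a null set. *)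
pose z x := lim (a k x @[k --> \oo]).
pose f k x := oscillation (N k.+1 - N k) (N k) x.
have NS k : (N k.+1 - N k + N k)%N = N k.+1 by rewrite subnK// Nmono.
have fE k x : s0 <= x -> x < s1 -> `|a k.+1 x - a k x| = f k x.
  by move=> s0x xs1; rewrite /a -(NS k) oscillationE.
have f_ge0 k x : (0 <= (f k x)%:E)%E by rewrite lee_fin oscillation_ge0.
(* The tail sum [g K] dominates [|z - a K|] wherever it is finite, and its integral is at most a
   geometric tail, whose factor 2 enters [C]. *)
pose g K x : \bar R := (\sum_(k <oo) (f (k + K)%N x)%:E)%E.
pose C : R := 2 * (s1 - s0 + 1).
have int_f k : (\int[mu]_(x in `[s0, s1[) (f k x)%:E <=
    (2^-1 ^+ k * (s1 - s0 + 1))%:E)%E.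
  by apply: integral_oscillation; rewrite ?exprn_gt0// NS.
have int_g K : (\int[mu]_(x in `[s0, s1[) g K x <= (C * 2^-1 ^+ K)%:E)%E.
  rewrite integral_nneseries//; last by move=> k; exact: measurable_oscillation.
  apply: lime_le; first by apply: is_cvg_nneseries => k _ _; exact: integral_ge0.
  apply: nearW => n.
  rewrite (@le_trans _ _
    (\sum_(0 <= k < n) (2^-1 ^+ (k + K) * (s1 - s0 + 1))%:E)%E)//.
    by apply: lee_sum => k _; exact: int_f.
  rewrite sumEFin lee_fin.
  under eq_bigr do rewrite exprD -mulrA mulrC.
  rewrite -mulr_sumr.
  have := @geometric_le_lim R n 1 2^-1 ler01.
  rewrite invr_gt0 ltr0n ger0_norm// invf_lt1// ltr1n => /(_ isT isT).
  rewrite /series/=; under eq_bigr do rewrite mul1r.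
  have -> : 1 - 2^-1 = 2^-1 :> R by field.
  rewrite invrK mul1r => sum2.
  rewrite (le_trans (ler_wpM2l _ sum2))//.
    by rewrite mulr_ge0 ?exprn_ge0// addr_ge0// subr_ge0 ltW.
  by rewrite le_eqVlt; apply/orP; left; apply/eqP; rewrite /C; ring.
have a_lim K x : s0 <= x -> x < s1 -> (g K x < +oo)%E ->
    a k x @[k --> \oo] --> z x /\ ((`|z x - a K x|%R)%:E <= g K x)%E.
  move=> s0x xs1 goo.
  have gfin : g K x = (fine (g K x))%:E.
    by rewrite fineK// ge0_fin_numE// nneseries_ge0.
  have [l al lB] : exists2 l, a (k + K)%N x @[k --> \oo] --> l &
      `|l - a (0 + K)%N x| <= fine (g K x).
    apply: summable_increments_cvg => j.
    rewrite -lee_fin -gfin.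
    under eq_bigr do rewrite addSn fE//.
    by rewrite -sumEFin; exact: nneseries_lim_ge.
  rewrite add0n in lB.
  have {}al : a k x @[k --> \oo] --> l.
    by move: al; rewrite (cvg_shiftn K (fun k => a k x)).
  have -> : z x = l by exact: cvg_lim al.
  by rewrite gfin lee_fin.
have C0 : 0 <= C by rewrite mulr_ge0// addr_ge0// subr_ge0 ltW.
have ae_lim : {ae mu, forall x, `[s0, s1[%classic x -> a k x @[k --> \oo] --> z x}.
  have mg : measurable_fun `[s0, s1[ (g 0%N).
    by apply: ge0_emeasurable_sum => // k _; exact: measurable_oscillation.
  have ig : mu.-integrable `[s0, s1[ (g 0%N).
    apply/integrableP; split=> //.
    under eq_integral do rewrite gee0_abs ?nneseries_ge0//.
    by rewrite (le_lt_trans (int_g 0%N))// ltry.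
  have mD : measurable (`[s0, s1[%classic : set (measurableTypeR R)).
    exact: measurable_itv.
  apply: filterS (integrable_ae mD ig) => x gx xD.
  move: (xD); rewrite /= in_itv/= => /andP[s0x xs1].
  by have [] := a_lim 0%N x s0x xs1 _; rewrite // -ge0_fin_numE ?nneseries_ge0// gx.
exists z => t s0t ts1.
have sub : (`[s0, t[%classic : set R) `<=` `[s0, s1[%classic.
  by move=> x /=; rewrite !in_itv/= => /andP[-> /lt_le_trans]; exact.
have simple k : simple_on mu `[s0, t[ (dyadic_slopes (N k)).
  by apply: dyadic_simple_on.
split.
  exists (dyadic_slopes \o N) => //.
  apply: (@filterS _ _ (ae_filter_ringOfSetsType _)) ae_lim => x al xt.
  by apply: al; exact: sub.
exists (dyadic_slopes \o N); last exact: simple_integral_cvg.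
split=> //.
apply: (@squeeze_cvge _ _ _ _ (cst 0%E) _ (fun K => (C * 2^-1 ^+ K)%:E)).
- apply: nearW => K; rewrite integral_ge0/=; last by move=> x _; rewrite lee_fin.
  apply: le_trans (int_g K); apply: ge0_integral_mono => //.
  + by move=> x _; apply: nneseries_ge0.
  (* Where [g K] is infinite the bound is trivial, so no null set has to be removed. *)
  + move=> x /sub; rewrite /= in_itv/= => /andP[s0x xs1].
    have [goo|] := ltP (g K x) +oo%E; first exact: (a_lim K x s0x xs1 goo).2.
    by rewrite leye_eq => /eqP ->; rewrite leey.
- exact: cvg_cst.
- apply: cvg_EFin; first exact: nearW.
  rewrite -[X in _ --> X](mulr0 C); apply: cvgMr.
  by apply: cvg_expr; rewrite ger0_norm// invf_lt1 ?ltr1n.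
Qed.

End dyadic_density.

Lemma lipschitz_absolutely_continuous (R : realType) (H : completeNormedModType R)
    (ip : {dot H for idfun}) (s0 s1 L : R) (b : R -> H) :
  induces_norm ip -> s0 <= s1 -> 0 <= L ->
  (forall s t, s0 <= s -> s <= t -> t <= s1 -> `|b t - b s| <= L * (t - s)) ->
  absolutely_continuous_on s0 s1 b.
Proof.
move=> ip_norm; rewrite le_eqVlt => /orP[/eqP <-|s01] L0 bL; last first.
  have [z zP] := lipschitz_density ip_norm s01 L0 bL.
  exists z => //; have [? [s ? _]] := zP s1 (ltW s01) (lexx _).
  by split=> //; exists s.
(* When [s0 = s1] all intervals are empty and the empty simple function approximates the zero
   density. *)
have z0 t : s0 <= t -> t <= s0 -> has_bochner_integral (@lebesgue_measure R)
    `[s0, t[ (cst 0 : R -> H) (b t - b s0).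
  move=> s0t ts0; have -> : t = s0 by apply/eqP; rewrite eq_le ts0.
  rewrite subrr set_itvco0; split.
    exists (fun=> [::]) => //; apply: aeW => x [].
  exists (fun=> [::]); last by rewrite /simple_integral big_nil; exact: cvg_cst.
  by split=> //; rewrite integral_set0; exact: cvg_cst.
exists (cst 0) => //; have [? [s ? _]] := z0 s0 (lexx _) (lexx _).
by split=> //; exists s.
Qed.

(** * Weak continuity of absolutely continuous curves *)

Section weak_integral.
Context {R : realType} {H : completeNormedModType R} (ip : {dot H for idfun}).
Hypothesis ip_norm : induces_norm ip.
Context {d : measure_display} {T : measurableType d}.
Variables (mu : {measure set T -> \bar R}) (e : H).

Let coord (s : seq (set T * H)) (x : T) : R := ip (simple_eval s x) e.

Let coord_cons p s : coord (p :: s) = \1_(p.1) \* cst (ip p.2 e) \+ coord s.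
Proof.
by apply/funext => x; rewrite /coord /simple_eval big_cons ipDl ipZl.
Qed.

Let ip0 : ip 0 e = 0. Proof. by rewrite linear0l. Qed.

Let coord_nil : coord [::] = cst 0.
Proof. by apply/funext => x; rewrite /coord /simple_eval big_nil ip0. Qed.

Lemma measurable_coord (D : set T) s :
  (forall p, p \in s -> measurable p.1) -> measurable_fun D (coord s).
Proof.
elim: s => [|p s IH] ms; first by rewrite coord_nil.
rewrite coord_cons; apply: measurable_funD.
  apply: measurable_funM => //; apply: measurable_indic.
  by apply: ms; rewrite mem_head.
by apply: IH => q qs; apply: ms; rewrite inE qs orbT.
Qed.

Lemma integral_coord (D : set T) s : measurable D -> simple_on mu D s ->
  mu.-integrable D (EFin \o coord s) /\
  (\int[mu]_(x in D) (coord s x)%:E)%E = (ip (simple_integral mu D s) e)%:E.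
Proof.
move=> mD; elim: s => [|p s IH] ss.
  rewrite coord_nil /simple_integral big_nil ip0; split; last exact: integral0.
  exact: integrable0.
have [mp fp] := ss p (mem_head _ _).
have [is_ Is] := IH (fun q qs => ss q (mem_behead (s := p :: s) qs)).
have ind : mu.-integrable D (fun x => (\1_(p.1) x)%:E).
  apply/integrableP; split.
    by apply/measurable_EFinP; exact: measurable_indic.
  under eq_integral do rewrite gee0_abs ?lee_fin//.
  by rewrite integral_indic// setIC.
have ip_ : mu.-integrable D (fun x => (\1_(p.1) x)%:E * (ip p.2 e)%:E)%E.
  exact: integrableZr.
have cE x : (coord (p :: s) x)%:E =
    ((\1_(p.1) x)%:E * (ip p.2 e)%:E + (coord s x)%:E)%E.
  by rewrite coord_cons.
split.
  have := integrableD mD ip_ is_; congr (integrable _ _ _).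
  by apply/funext => x /=; rewrite cE.
under eq_integral do rewrite cE.
rewrite integralD// integralZr// integral_indic// Is.
rewrite setIC /simple_integral big_cons ipDl ipZl EFinD EFinM fineK//.
by rewrite ge0_fin_numE.
Qed.

Variables (D0 N : set T) (z : T -> H).
Hypotheses (mD0 : measurable D0) (mN : measurable N) (muN : mu N = 0%E).

(** Cutting the component of [z] along [e] to 0 off [D0] and on [N] gives one globally measurable
    scalar function, shared by all subintervals. *)
Let zeta := (fun x => ip (z x) e) \_ (D0 `\` N).

Lemma measurable_ip_limit (s : nat -> seq (set T * H)) :
  (forall n, simple_on mu D0 (s n)) ->
  (forall x, D0 x -> ~ N x -> simple_eval (s n) x @[n --> \oo] --> z x) ->
  measurable_fun setT zeta.
Proof.
move=> ss sz; apply/(measurable_restrictT _ (measurableD mD0 mN)).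
apply: (@measurable_fun_cvg _ _ _ _ (fun n => coord (s n))).
  by move=> n; apply: measurable_coord => p /ss[].
by move=> x [Dx Nx]; apply: (ip_cvg ip_norm); exact: sz.
Qed.

Hypothesis mzeta : measurable_fun setT zeta.

Lemma coord_dist (D : set T) s : measurable D -> D `<=` D0 -> simple_on mu D s ->
  (\int[mu]_(x in D) (`|zeta x - coord s x|)%:E <=
   (`|e| + 1)%:E * \int[mu]_(x in D) (`|z x - simple_eval s x|%R)%:E)%E.
Proof.
move=> mD DD0 ss.
have e1 : 0 < `|e| + 1 by rewrite ltr_wpDl.
have mzs : measurable_fun D (fun x => (`|zeta x - coord s x|)%:E).
  apply/measurable_EFinP; apply: measurableT_comp => //; apply: measurable_funB.
    exact: measurable_funS mzeta.
  by apply: measurable_coord => p /ss[].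
rewrite (ge0_negligible_integral mN)//.
(* The constant moves to the left, where the integrand is measurable and the scalar can be pulled
   inside. *)
rewrite -lee_pdivrMl//.
have mzs' : measurable_fun (D `\` N) (fun x => (`|zeta x - coord s x|)%:E).
  by apply: measurable_funS mzs.
rewrite -ge0_integralZl_EFin//; last exact: measurableD.
apply: ge0_integral_mono.
- by move=> x [].
- by move=> x _; rewrite -EFinM lee_fin mulr_ge0// invr_ge0 ltW.
- by move=> x _; rewrite lee_fin.
move=> x [Dx Nx]; rewrite -EFinM lee_fin mulrC ler_pdivrMr//.
rewrite /zeta patchE mem_set; last by split=> //; exact: DD0.
rewrite /coord -ipNl -ipDl (le_trans (ip_le_norm ip_norm _ _))//.
by rewrite ler_wpM2l// lerDl.
Qed.

(** Pairing with [e] commutes with integration of simple functions, and [coord_dist] carries this to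
    the limit. *)
Lemma ip_bochner_integral (D : set T) I : measurable D -> D `<=` D0 ->
  has_bochner_integral mu D z I ->
  mu.-integrable D (EFin \o zeta) /\
  (\int[mu]_(x in D) (zeta x)%:E)%E = (ip I e)%:E.
Proof.
move=> mD DD0 [_ [s [ss sz] sI]].
have dist n := coord_dist mD DD0 (ss n).
have coords n := integral_coord mD (ss n).
have mz : measurable_fun D (EFin \o zeta).
  by apply/measurable_EFinP; exact: measurable_funS mzeta.
have dist_cvg : ((`|e| + 1)%:E * \int[mu]_(x in D)
    (`|z x - simple_eval (s n) x|%R)%:E)%E @[n --> \oo] --> 0%E.
  by rewrite -(mule0 (`|e| + 1)%:E); apply: cvgeZl.
have /fine_cvgP[dist_fin dist_cvg0] := dist_cvg.
have zcint n : ((`|e| + 1)%:E * \int[mu]_(x in D)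
    (`|z x - simple_eval (s n) x|%R)%:E)%E \is a fin_num ->
    mu.-integrable D (EFin \o (fun x => zeta x - coord (s n) x)).
  move=> fn; apply/integrableP; split.
    apply/measurable_EFinP; apply: measurable_funB; first exact/measurable_EFinP.
    by apply: measurable_coord => p /ss[].
  by apply: le_lt_trans (dist n) _; rewrite ltey_eq fn.
(* One index with finite distance is enough: [zeta] is then an integrable difference plus an
   integrable simple function. *)
have zint : mu.-integrable D (EFin \o zeta).
  have [n _ /(_ n (leqnn n)) /= fn] := dist_fin.
  have := integrableD mD (zcint n fn) (coords n).1; congr (integrable _ _ _).
  by apply/funext => x /=; rewrite -EFinD subrK.
split=> //.
have zfin : (\int[mu]_(x in D) (zeta x)%:E)%E \is a fin_num.
  exact: (integrable_fin_num mD zint).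
rewrite -(fineK zfin); congr EFin.
have coord_cvg : ip (simple_integral mu D (s n)) e @[n --> \oo] --> ip I e.
  exact: (ip_cvg ip_norm).
apply: (cvg_unique _ _ coord_cvg) => //.
apply/cvgrPdist_le => eps eps0.
have /cvgrPdist_le/(_ _ eps0) := dist_cvg0.
apply: filterS2 dist_fin => n fn; rewrite sub0r normrN => /ler_normlW/=.
apply: le_trans; rewrite -lee_fin fineK//.
apply: le_trans (dist n).
have -> : (`|fine (\int[mu]_(x in D) (zeta x)%:E) -
      ip (simple_integral mu D (s n)) e|%:E = `| \int[mu]_(x in D) (zeta x - coord (s n) x)%:E |)%E.
  under [in RHS]eq_integral do rewrite EFinB.
  rewrite integralB_EFin//; last exact: (coords n).1.
  by rewrite (coords n).2 -[X in (`|X - _|)%E](fineK zfin).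
exact: le_abse_integral (measurable_int _ (zcint n fn)).
Qed.

End weak_integral.

Lemma absolutely_continuous_weakly_continuous (R : realType)
    (H : completeNormedModType R) (ip : {dot H for idfun}) (s0 s1 : R)
    (b : R -> H) (e : H) :
  induces_norm ip -> s0 <= s1 -> absolutely_continuous_on s0 s1 b ->
  {within `[s0, s1], continuous (fun t => ip (b t) e)}.
Proof.
move=> ip_norm s01 [z [[s ss [N [mN muN Nz]]] _] zP].
pose D0 : set (measurableTypeR R) := `[s0, s1[%classic.
have mI t : measurable (`[s0, t[%classic : set (measurableTypeR R)).
  exact: measurable_itv.
have sz x : D0 x -> ~ N x -> simple_eval (s n) x @[n --> \oo] --> z x.
  by move=> Dx Nx; apply: contrapT => xz; apply: Nx; apply: Nz => /(_ Dx).
have mz := measurable_ip_limit ip_norm e (mI s1) mN ss sz.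
set zeta := (_ \_ _) in mz.
have sub t : t <= s1 -> (`[s0, t[%classic : set (measurableTypeR R)) `<=` D0.
  by move=> ts1 x /=; rewrite /D0/= !in_itv/= => /andP[-> /lt_le_trans]; exact.
have key t (s0t : s0 <= t) (ts1 : t <= s1) :=
  ip_bochner_integral ip_norm mN muN mz (mI t) (sub t ts1) (zP t s0t ts1).
(* Integrability extends from the half-open to the closed interval, as [zeta] vanishes outside the
   former. *)
have zint : (@lebesgue_measure R).-integrable `[s0, s1] (EFin \o zeta).
  have [+ _] := key s1 s01 (lexx _).
  move=> /(integrable_mkcond _ (mI s1)).1.
  have -> : (EFin \o zeta) \_ `[s0, s1[ = EFin \o zeta.
    apply/funext => x; rewrite patchE; case: ifPn => //= xD.
    rewrite /zeta patchE memNset// => -[Dx _].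
    by move: xD; rewrite (mem_set Dx).
  by apply: integrableS => //; exact: measurable_itv.
have := parameterized_integral_continuous s01 zint.
set F := fun t => parameterized_integral _ s0 t zeta => cF.
have FE t : s0 <= t -> t <= s1 -> ip (b t) e = ip (b s0) e + F t.
  move=> s0t ts1; have [zi zE] := key t s0t ts1.
  rewrite /F /parameterized_integral -Rintegral_itv_bndo_bndc//.
  by rewrite /Rintegral zE/= ipDl ipNl addrC subrK.
apply/(@subspace_eq_continuous _ _ _ (fun t => ip (b s0) e + F t)).
  move=> t; rewrite inE/= in_itv/= => /andP[s0t ts1].
  by rewrite -FE.
move=> t; apply: cvgD; first exact: cvg_cst.
exact: cF.
Qed.

(** * Derivatives on the half-line *)

Section one_sided_derivative.
Context {R : realType}.
Variable t0 : R.

(** First-order expansion on the half-line, free of division and covering both the right derivative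
    at [t0] and the two-sided one beyond it. *)
Definition has_derivative (V : normedModType R) (w : R -> V) (t : R) (l : V) :=
  forall e, 0 < e -> exists2 d, 0 < d & forall s, t0 <= s -> `|s - t| < d ->
    `|w s - w t - (s - t) *: l| <= e * `|s - t|.

Lemma diff_quotientP (H : completeNormedModType R) (w : R -> H) t l :
  diff_quotient t0 w t --> l <-> has_derivative w t l.
Proof.
have eqn s : s != t ->
    `|l - (s - t)^-1 *: (w s - w t)| * `|s - t| = `|w s - w t - (s - t) *: l|.
  move=> st; have st0 : s - t != 0 by rewrite subr_eq0.
  rewrite mulrC -normrZ scalerBr scalerA mulfV// scale1r.
  by rewrite distrC.
split=> [/cvgrPdist_le dl e e0|dl].
  have /nbhs_ballP[d /= d0 dP] := dl e e0.
  exists d => // s t0s sd; have [->|st] := eqVneq s t.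
    by rewrite !subrr scale0r subr0 !normr0 mulr0.
  rewrite -eqn// ler_wpM2r//; apply: dP => //=; last by rewrite in_itv/= t0s.
  by rewrite -ball_normE /= distrC.
apply/cvgrPdist_le => e e0; have [d d0 dP] := dl e e0.
apply/nbhs_ballP; exists d => //= s; rewrite -ball_normE /= distrC => sd st.
rewrite in_itv/= andbT => t0s; have := dP s t0s sd.
by rewrite -eqn// ler_pM2r// normr_gt0 subr_eq0.
Qed.

(** Properness makes the limit defining [derive_from] unique, also at [t0]. *)
Lemma right_nbhs_proper t : t0 <= t -> ProperFilter (within `[t0, +oo[ t^').
Proof.
move=> t0t; apply: Build_ProperFilter_ex => A /nbhs_ballP[d /= d0 dP].
exists (t + d / 2); apply: dP.
- by rewrite -ball_normE /= opprD addNKr normrN gtr0_norm; lra.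
- by rewrite -subr_eq0 addrAC subrr add0r gt_eqF// divr_gt0.
- by rewrite in_itv/= andbT; lra.
Qed.

Lemma derive_fromE (H : completeNormedModType R) (w : R -> H) t l : t0 <= t ->
  has_derivative w t l -> derivable_from t0 w t /\ derive_from t0 w t = l.
Proof.
move=> t0t /diff_quotientP wl; have PF := right_nbhs_proper t0t.
by split; [apply/cvg_ex; exists l|exact: cvg_lim].
Qed.

Lemma derivable_fromP (H : completeNormedModType R) (w : R -> H) t :
  derivable_from t0 w t -> has_derivative w t (derive_from t0 w t).
Proof. by move=> wt; apply/diff_quotientP. Qed.

Lemma eq_has_derivative (V : normedModType R) (w w' : R -> V) t l :
  t0 <= t -> (forall s, t0 <= s -> w s = w' s) ->
  has_derivative w t l -> has_derivative w' t l.
Proof.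
move=> t0t ww' wl e /wl[d d0 dP]; exists d => // s t0s.
by rewrite -!ww'//; exact: dP.
Qed.

Lemma has_derivative_cont (V : normedModType R) (w : R -> V) t l :
  has_derivative w t l -> forall e, 0 < e -> exists2 d, 0 < d &
    forall s, t0 <= s -> `|s - t| < d -> `|w s - w t| <= e.
Proof.
move=> wl e e0; have [d d0 dP] := wl 1 ltr01.
have l1 : 0 < 1 + `|l| by rewrite ltr_pwDl.
exists (Num.min d (e / (1 + `|l|))); first by rewrite lt_min d0 divr_gt0.
move=> s t0s; rewrite lt_min ltr_pdivlMr// => /andP[sd se].
rewrite -[w s - w t](subrK ((s - t) *: l)) (le_trans (ler_normD _ _))//.
rewrite (le_trans _ (ltW se))// mulrDr mulr1 normrZ lerD2r.
by rewrite (le_trans (dP s t0s sd))// mul1r.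
Qed.

Lemma has_derivativeB (V : normedModType R) (w w' : R -> V) t l l' :
  has_derivative w t l -> has_derivative w' t l' ->
  has_derivative (fun s => w s - w' s) t (l - l').
Proof.
move=> wl wl' e e0; have e2 : 0 < e / 2 by rewrite divr_gt0.
have [d d0 dP] := wl _ e2; have [d' d'0 d'P] := wl' _ e2.
exists (Num.min d d'); first by rewrite lt_min d0.
move=> s t0s; rewrite lt_min => /andP[sd sd'].
rewrite [X in `|X|](_ : _ =
  (w s - w t - (s - t) *: l) - (w' s - w' t - (s - t) *: l')).
  rewrite (le_trans (ler_normB _ _))//.
  by have := dP s t0s sd; have := d'P s t0s sd'; lra.
have aux (x y x' y' : V) : x - y - (x' - y') = (x - x') - (y - y').
  by rewrite !opprD !opprK addrACA.
by rewrite scalerBr (aux (w s)) (aux (w s - w t)).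
Qed.

Lemma has_derivativeD (w w' : R -> R^o) t l l' :
  has_derivative w t l -> has_derivative w' t l' ->
  has_derivative (fun s => w s + w' s : R^o) t (l + l').
Proof.
move=> wl wl' e e0; have e2 : 0 < e / 2 by rewrite divr_gt0.
have [d d0 dP] := wl _ e2; have [d' d'0 d'P] := wl' _ e2.
exists (Num.min d d'); first by rewrite lt_min d0.
move=> s t0s; rewrite lt_min => /andP[sd sd'].
rewrite [X in `|X|](_ : _ =
  (w s - w t - (s - t) *: l) + (w' s - w' t - (s - t) *: l')).
  rewrite (le_trans (ler_normD _ _))//.
  by have := dP s t0s sd; have := d'P s t0s sd'; lra.
by rewrite /GRing.scale/=; ring.
Qed.

Lemma has_derivative_norm_sqr (H : normedModType R) (ip : {dot H for idfun})
    (ip_norm : forall x : H, `|x| = Num.sqrt (ip x x)) (w : R -> H) t l :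
  has_derivative w t l ->
  has_derivative (fun s => `|w s| ^+ 2 : R^o) t (2 * ip (w t) l).
Proof.
move=> wl e e0.
(* [M] dominates both [2 |w t|] and the local Lipschitz constant [1 + |l|], so the linear and the
   quadratic remainder each take half of [e]. *)
pose M := 2 * `|w t| + 1 + `|l|.
have M0 : 0 < M by rewrite ltr_wpDr// ltr_wpDl// mulr_ge0.
have wM : 2 * `|w t| <= M by rewrite /M -addrA lerDl addr_ge0.
have lM : 1 + `|l| <= M by rewrite /M -addrA lerDr mulr_ge0.
have eM : 0 < Num.min 1 (e / (2 * M)) by rewrite lt_min ltr01 divr_gt0// mulr_gt0.
have [d d0 dP] := wl _ eM.
have d'0 : 0 < e / (2 * M ^+ 2) by rewrite divr_gt0// mulr_gt0// exprn_gt0.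
exists (Num.min d (e / (2 * M ^+ 2))); first by rewrite lt_min d0.
move=> s t0s; rewrite lt_min => /andP[sd sd'].
have := dP s t0s sd; set r := w s - w t - (s - t) *: l => rs.
have r1 : `|r| <= `|s - t|.
  by rewrite (le_trans rs)// ler_piMl// ge_min lexx.
have r2 : `|r| <= e / (2 * M) * `|s - t|.
  by rewrite (le_trans rs)// ler_wpM2r// ge_min lexx orbT.
set x := w s - w t.
have xM : `|x| <= M * `|s - t|.
  rewrite (@le_trans _ _ ((1 + `|l|) * `|s - t|)) ?ler_wpM2r//.
  rewrite -[x](subrK ((s - t) *: l)) (le_trans (ler_normD _ _))// normrZ.
  by rewrite mulrDl mul1r (mulrC `|l|) lerD2r.
rewrite (_ : _ - _ = 2 * ip (w t) r + `|x| ^+ 2); last first.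
  rewrite -!(ipE ip_norm) /r /x !(ip_lin ip) (ipC ip (w s) (w t)).
  by rewrite /GRing.scale/=; ring.
rewrite (le_trans (ler_normD _ _))// normrM (ger0_norm (_ : 0 <= 2))//.
rewrite [`| `|x| ^+ 2|]ger0_norm ?sqr_ge0//.
have h1 : 2 * `|ip (w t) r| <= e / 2 * `|s - t|.
  rewrite (@le_trans _ _ (M * `|r|))//.
    rewrite (le_trans _ (ler_wpM2r (normr_ge0 r) wM))// -mulrA ler_wpM2l//.
    exact: ip_le_norm.
  rewrite (le_trans (ler_wpM2l (ltW M0) r2))// le_eqVlt; apply/orP; left.
  by apply/eqP; field; rewrite gt_eqF.
have h2 : `|x| ^+ 2 <= e / 2 * `|s - t|.
  rewrite (@le_trans _ _ ((M * `|s - t|) ^+ 2))//.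
    by rewrite lerXn2r ?nnegrE ?mulr_ge0// ltW.
  rewrite exprMn expr2 [X in _ * X]expr2 mulrA ler_wpM2r//.
  move: sd'; rewrite ltr_pdivlMr ?mulr_gt0 ?exprn_gt0// expr2.
  by move=> /ltW; lra.
by lra.
Qed.

Lemma has_derivative_is_derive (f : R -> R) t (l : R) : t0 < t ->
  has_derivative (f : R -> R^o) t l -> is_derive t 1 f l.
Proof.
move=> t0t fl.
have fl' : h^-1 *: ((f \o shift t) (h *: 1) - f t) @[h --> 0^'] --> (l : R^o).
  apply/cvgrPdist_le => e e0; have [d d0 dP] := fl e e0.
  have m0 : 0 < Num.min d (t - t0) by rewrite lt_min d0 subr_gt0.
  apply/nbhs_ballP; exists (Num.min d (t - t0)) => //= h.
  rewrite -ball_normE /= sub0r normrN lt_min => /andP[hd ht] h0.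
  have t0s : t0 <= h + t.
    by have := ler_norm (- h); rewrite normrN => hh; move: ht; lra.
  have := dP (h + t) t0s; rewrite addrK => /(_ hd) dl.
  have h0' : 0 < `|h| by rewrite normr_gt0.
  rewrite -(ler_pM2r h0') -normrM (le_trans _ dl)// -normrN.
  rewrite /GRing.scale/= mulr1 le_eqVlt; apply/orP; left; apply/eqP; congr `|_|.
  by field.
split; first by apply/cvg_ex; exists l.
exact: cvg_lim fl'.
Qed.

(** The function [exp (- C s) f s] vanishes at [t0] and has nonpositive derivative; the mean value
    theorem uses derivatives on the open interval and only continuity at [t0]. *)
Lemma gronwall (f l : R -> R) (C : R) : f t0 = 0 ->
  (forall t, t0 <= t -> has_derivative (f : R -> R^o) t (l t)) ->
  (forall t, t0 <= t -> l t <= C * f t) ->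
  forall t, t0 <= t -> f t <= 0.
Proof.
move=> f0 fl lC t; rewrite le_eqVlt => /orP[/eqP <-|t0t]; first by rewrite f0.
pose E (s : R) : R := expR (- C * s).
have dE (s : R) : is_derive s 1 E (- C * E s).
  have dC : is_derive s 1 ( *%R (- C)) (- C).
    by have := is_deriveZ (- C) (is_derive_id s 1); rewrite /GRing.scale/= mulr1.
  by have := is_derive1_comp (is_derive_expR (- C * s)) dC; rewrite mulrC.
have dEf (s : R) : s \in `]t0, t[ ->
    is_derive s 1 (E * f) (E s * l s + f s * (- C * E s)).
  rewrite in_itv/= => /andP[t0s _].
  have dfs := has_derivative_is_derive t0s (fl s (ltW t0s)).
  have dEs := dE s.
  exact: is_deriveM.
have cE : {within `[t0, t], continuous (E * f)}.
  apply/subspace_continuousP => s; rewrite /= in_itv/= => /andP[t0s _].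
  apply: cvgM.
    apply: cvg_within_filter; apply: differentiable_continuous.
    by apply/derivable1_diffP; have [] := dE s.
  apply/cvgrPdistC_le => e e0.
  have [d d0 dP] := has_derivative_cont (fl s t0s) e0.
  apply/nbhs_ballP; exists d => //= r; rewrite -ball_normE /= distrC => rd.
  by rewrite in_itv/= => /andP[t0r _]; exact: dP.
have [c] := MVT t0t dEf cE.
rewrite in_itv/= => /andP[t0c _]; rewrite /= !fctE f0 mulr0 subr0 => Eft.
have := lC c (ltW t0c); rewrite -subr_le0 => h.
have : E t * f t <= 0.
  rewrite Eft (_ : _ * _ = E c * (t - t0) * (l c - C * f c)); last by ring.
  by rewrite mulr_ge0_le0// mulr_ge0 ?expR_ge0// subr_ge0 ltW.
by rewrite pmulr_rle0// expR_gt0.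
Qed.

End one_sided_derivative.

(** * The third-order equation *)

Section third_order.
Context {R : realType} {H : completeNormedModType R} (ip : {dot H for idfun}).
Hypothesis ip_norm : induces_norm ip.
Variables (a0 a1 a2 t0 K : R) (G : H -> H).
Hypotheses (a0_gt0 : 0 < a0) (a1_gt0 : 0 < a1) (a2_gt0 : 0 < a2) (K_ge0 : 0 <= K).
Hypothesis G_lip : forall x y, `|G x - G y| <= K * `|x - y|.

Let rhs (x y z : H) : H := - (a2 *: z + a1 *: y + a0 *: G x).

Let rhs_lip x y z x' y' z' : `|rhs x y z - rhs x' y' z'| <=
  a2 * `|z - z'| + a1 * `|y - y'| + a0 * K * `|x - x'|.
Proof.
rewrite /rhs -opprD normrN.
have -> : a2 *: z + a1 *: y + a0 *: G x - (a2 *: z' + a1 *: y' + a0 *: G x') =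
    a2 *: (z - z') + a1 *: (y - y') + a0 *: (G x - G x').
  by rewrite !scalerBr opprD addrACA opprD (addrACA (a2 *: z)).
rewrite (le_trans (ler_normD _ _))// lerD//.
  rewrite (le_trans (ler_normD _ _))// !normrZ !gtr0_norm//.
by rewrite normrZ gtr0_norm// -mulrA ler_pM2l.
Qed.

Let Phi (x : H * H * H) : H * H * H := (x.1.2, x.2, rhs x.1.1 x.1.2 x.2).

Let norm1 (x : H * H * H) : `|x.1.1| <= `|x|.
Proof. by rewrite !prod_normE !le_max lexx. Qed.

Let norm2 (x : H * H * H) : `|x.1.2| <= `|x|.
Proof. by rewrite !prod_normE !le_max lexx !orbT. Qed.

Let norm3 (x : H * H * H) : `|x.2| <= `|x|.
Proof. by rewrite !prod_normE !le_max lexx !orbT. Qed.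

(** In the max norm of the product, [1] accounts for the two shifted coordinates and the other terms
    for [rhs]. *)
Let L := 1 + a2 + a1 + a0 * K.

Let L_ge0 : 0 <= L.
Proof. by rewrite !addr_ge0 ?mulr_ge0// ltW. Qed.

Let Phi_lip x y : `|Phi x - Phi y| <= L * `|x - y|.
Proof.
have aK : 0 <= a0 * K by rewrite mulr_ge0// ltW.
have n0 := normr_ge0 (x - y).
have n1 := norm1 (x - y); have n2 := norm2 (x - y); have n3 := norm3 (x - y).
have L1 : `|x - y| <= L * `|x - y|.
  by rewrite ler_peMl// /L -!addrA lerDl !addr_ge0// ltW.
rewrite [`|Phi x - _|]prod_normE [`|(_ - _).1|]prod_normE !ge_max.
apply/andP; split; first by apply/andP; split; exact: le_trans L1.
rewrite (le_trans (rhs_lip _ _ _ _ _ _))//.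
have := ler_wpM2l (ltW a2_gt0) n3; have := ler_wpM2l (ltW a1_gt0) n2.
by have := ler_wpM2l aK n1; rewrite /L /=; lra.
Qed.

Lemma third_order_exists (v0 v1 v2 : H) : exists p : nat -> R -> H,
  [/\ forall j t, (j < 3)%N -> t0 <= t -> has_derivative t0 (p j) t (p j.+1 t),
      forall j T, (j <= 3)%N -> exists2 C, 0 <= C &
        forall s t, t0 <= s -> s <= t -> t <= T ->
          `|p j t - p j s| <= C * (t - s),
      forall t, p 3 t = rhs (p 0 t) (p 1 t) (p 2 t) &
      [/\ p 0 t0 = v0, p 1 t0 = v1 & p 2 t0 = v2]].
Proof.
have [u u0 uP] := lipschitz_flow L_ge0 Phi_lip (v0, v1, v2).
pose v t := u (t - t0).
have vP T : exists2 C, 0 <= C & forall s t, t0 <= s -> s <= t -> t <= T ->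
    `|v t - v s| <= C * (t - s) /\
    `|v t - v s - (t - s) *: Phi (v s)| <= C * (t - s) ^+ 2.
  have [C C0 CP] := uP (T - t0); exists C => // s t t0s st tT.
  have [] := CP (s - t0) (t - t0); rewrite ?subr_ge0 ?lerD2r//.
  by rewrite opprB addrA subrK.
have dv t : t0 <= t -> has_derivative t0 v t (Phi (v t)).
  move=> t0t e e0; have [C C0 CP] := vP (t + 1).
  pose M := C + L * C + 1.
  have LC : 0 <= L * C by rewrite mulr_ge0.
  have M0 : 0 < M by rewrite ltr_wpDl// addr_ge0.
  exists (Num.min 1 (e / M)); first by rewrite lt_min ltr01 divr_gt0.
  move=> s t0s; rewrite lt_min ltr_pdivlMr// => /andP[s1 sM].
  have sM' : `|s - t| * `|s - t| * M <= e * `|s - t|.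
    by rewrite -mulrA mulrC ler_wpM2r// ltW.
  apply: le_trans sM'; rewrite -expr2 real_normK ?num_real//.
  have sq := sqr_ge0 (s - t).
  have [st|/ltW ts] := leP t s.
    have st1 : s <= t + 1 by move: s1 => /ltr_normlW; lra.
    have [_] := CP t s t0t st st1; move/le_trans; apply.
    by rewrite mulrC ler_wpM2l// /M; lra.
  have [h1 h2] := CP s t t0s ts (ltW (ltr_pwDr ltr01 (lexx t))).
  (* For [s < t] the estimate on the flow is based at [s]; moving the base point to [t] costs
     [L * C * (t - s)^2]. *)
  have -> : v s - v t - (s - t) *: Phi (v t) =
      (t - s) *: (Phi (v t) - Phi (v s)) - (v t - v s - (t - s) *: Phi (v s)).
    have aux (a b x y : H * H * H) : a - b + x = x - y - (b - a - y).
      by rewrite opprB opprB [RHS]addrA subrK addrC.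
    by rewrite -(opprB t s) scaleNr opprK scalerBr -aux.
  have ts0 : 0 <= t - s by rewrite subr_ge0.
  rewrite (le_trans (ler_normB _ _))// normrZ ger0_norm//.
  have h3 : `|Phi (v t) - Phi (v s)| <= L * (C * (t - s)).
    by rewrite (le_trans (Phi_lip _ _))// ler_wpM2l.
  have := ler_wpM2l ts0 h3; rewrite -(opprB t s) sqrrN.
  by rewrite /M; have := sqr_ge0 (t - s); nra.
pose p j t : H := match j with
  | 0 => (v t).1.1 | 1 => (v t).1.2 | 2 => (v t).2
  | _ => rhs (v t).1.1 (v t).1.2 (v t).2 end.
exists p; split=> //; last by rewrite /p /v subrr u0.
  move=> j t j3 t0t e e0; have [d d0 dP] := dv t t0t e e0; exists d => // s t0s sd.
  have := dP s t0s sd; case: j j3 => [|[|[|//]]] _; apply: le_trans.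
  - exact: (norm1 (v s - v t - (s - t) *: Phi (v t))).
  - exact: (norm2 (v s - v t - (s - t) *: Phi (v t))).
  - exact: (norm3 (v s - v t - (s - t) *: Phi (v t))).
move=> j T j3; have [C C0 CP] := vP T.
(* [C] serves the components of the flow, [L * C] the third derivative, which is a component of
   [Phi] along it. *)
exists (L * C + C); first by rewrite addr_ge0// mulr_ge0.
move=> s t t0s st tT; have [h1 _] := CP s t t0s st tT.
have ts : 0 <= C * (t - s) by rewrite mulr_ge0// subr_ge0.
have LC : 0 <= L * C * (t - s) by rewrite -mulrA mulr_ge0.
rewrite mulrDl; case: j j3 => [|[|[|[|//]]]] _.
- by have := norm1 (v t - v s); rewrite /=; lra.
- by have := norm2 (v t - v s); rewrite /=; lra.
- by have := norm3 (v t - v s); rewrite /=; lra.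
have := norm3 (Phi (v t) - Phi (v s)); have := Phi_lip (v t) (v s).
by have := ler_wpM2l L_ge0 h1; rewrite /=; lra.
Qed.

Lemma third_order_unique (p q : nat -> R -> H) :
  (forall j t, (j < 3)%N -> t0 <= t -> has_derivative t0 (p j) t (p j.+1 t)) ->
  (forall j t, (j < 3)%N -> t0 <= t -> has_derivative t0 (q j) t (q j.+1 t)) ->
  (forall t, t0 <= t -> p 3 t = rhs (p 0 t) (p 1 t) (p 2 t)) ->
  (forall t, t0 <= t -> q 3 t = rhs (q 0 t) (q 1 t) (q 2 t)) ->
  (forall j, (j < 3)%N -> p j t0 = q j t0) ->
  forall t, t0 <= t -> p 0 t = q 0 t.
Proof.
move=> dp dq p3 q3 pq0.
pose D j t := p j t - q j t.
have dD j t (j3 : (j < 3)%N) (t0t : t0 <= t) :=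
  has_derivativeB (dp j t j3 t0t) (dq j t j3 t0t).
pose psi t := `|D 0 t| ^+ 2 + `|D 1 t| ^+ 2 + `|D 2 t| ^+ 2.
pose l t := 2 * ip (D 0 t) (D 1 t) + 2 * ip (D 1 t) (D 2 t) +
  2 * ip (D 2 t) (D 3 t).
have dpsi t : t0 <= t -> has_derivative t0 (psi : R -> R^o) t (l t).
  move=> t0t; apply: (@has_derivativeD _ _ (fun s => `|D 0 s| ^+ 2 + `|D 1 s| ^+ 2)
    (fun s => `|D 2 s| ^+ 2)).
    apply: (@has_derivativeD _ _ (fun s => `|D 0 s| ^+ 2) (fun s => `|D 1 s| ^+ 2)).
      exact: (has_derivative_norm_sqr ip_norm (dD 0%N t isT t0t)).
    exact: (has_derivative_norm_sqr ip_norm (dD 1%N t isT t0t)).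
  exact: (has_derivative_norm_sqr ip_norm (dD 2%N t isT t0t)).
have psi0 : psi t0 = 0 by rewrite /psi /D !pq0// !subrr normr0 expr0n/= !addr0.
(* Young's inequality on each product in [l] leaves coefficients of the three squares that are at
   most this [C]. *)
pose C := 2 + 2 * a2 + a1 + a0 * K.
have aK : 0 <= a0 * K by rewrite mulr_ge0// ltW.
have lC t : t0 <= t -> l t <= C * psi t.
  move=> t0t.
  have two u v : 2 * ip u v <= `|u| ^+ 2 + `|v| ^+ 2.
    by have := sqr_ge0 `|u - v|; rewrite (normB_sqr ip_norm); lra.
  have h1 := two (D 0 t) (D 1 t); have h2 := two (D 1 t) (D 2 t).
  have h3 := le_trans (ler_norm _) (ip_le_norm ip_norm (D 2 t) (D 3 t)).
  have h4 : `|D 3 t| <= a2 * `|D 2 t| + a1 * `|D 1 t| + a0 * K * `|D 0 t|.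
    by rewrite {1}/D p3// q3// rhs_lip.
  have h5 := ler_wpM2l (normr_ge0 (D 2 t)) h4.
  rewrite /l /psi /C; move: h1 h2 h3 h5.
  set x := ip _ _; set y := ip _ _; set z := ip _ _.
  set d0 := `|D 0 t|; set d1 := `|D 1 t|; set d2 := `|D 2 t|; set d3 := `|D 3 t|.
  have q1 := mulr_ge0 (ltW a1_gt0) (sqr_ge0 (d1 - d2)).
  have q2 := mulr_ge0 aK (sqr_ge0 (d0 - d2)).
  have r1 := mulr_ge0 (ltW a1_gt0) (sqr_ge0 d0).
  have r2 := mulr_ge0 aK (sqr_ge0 d1).
  have r3 := mulr_ge0 (ltW a2_gt0) (sqr_ge0 d0).
  have r4 := mulr_ge0 (ltW a2_gt0) (sqr_ge0 d1).
  have r5 := sqr_ge0 d0; have r6 := sqr_ge0 d1; have r7 := sqr_ge0 d2.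
  move: q1 q2 r1 r2; set b := a0 * K.
  by move=> q1 q2 r1 r2 h1 h2 h3 h5; lra.
move=> t t0t; have := gronwall psi0 dpsi lC t0t.
have d0 := sqr_ge0 `|D 0 t|; have d1 := sqr_ge0 `|D 1 t|.
have d2 := sqr_ge0 `|D 2 t|.
move=> psi_le0; have : `|D 0 t| ^+ 2 = 0 by move: psi_le0; rewrite /psi; lra.
by move=> /eqP; rewrite sqrf_eq0 normr_eq0 subr_eq0 => /eqP.
Qed.

(** A defect [e] at [t] would, by continuity of the lower derivatives and weak continuity of [y 3],
    persist on an interval of positive measure. Weak continuity suffices because only the direction
    [e] is tested. *)
Lemma third_order_everywhere (y : nat -> R -> H) :
  (forall j t, (j < 3)%N -> t0 <= t -> has_derivative t0 (y j) t (y j.+1 t)) ->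
  locally_absolutely_continuous t0 (y 3) ->
  {ae @lebesgue_measure R, forall t, t0 <= t ->
     y 3 t + a2 *: y 2 t + a1 *: y 1 t + a0 *: G (y 0 t) = 0} ->
  forall t, t0 <= t -> y 3 t = rhs (y 0 t) (y 1 t) (y 2 t).
Proof.
move=> dy acy [N [mN muN Ny]] t t0t.
pose q s := rhs (y 0 s) (y 1 s) (y 2 s).
apply/eqP; rewrite -subr_eq0; apply/negPn/negP => e0.
set e := _ - _ in e0.
have ne : 0 < `|e| by rewrite normr_gt0.
have aK : 0 <= a0 * K by rewrite mulr_ge0// ltW.
have L_gt0 : 0 < L by rewrite /L -!addrA ltr_pwDl// !addr_ge0// ltW.
(* If the lower derivatives each move by at most this much, [rhs] moves by at most [|e| / 4]. *)
have eps0 : 0 < `|e| / (4 * L) by rewrite divr_gt0// mulr_gt0.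
have [d0 d00 dP0] := has_derivative_cont (dy 0%N t isT t0t) eps0.
have [d1 d10 dP1] := has_derivative_cont (dy 1%N t isT t0t) eps0.
have [d2 d20 dP2] := has_derivative_cont (dy 2%N t isT t0t) eps0.
have t0t1 : t0 <= t + 1 by lra.
have := @absolutely_continuous_weakly_continuous _ _ _ _ _ _ e ip_norm t0t1
  (acy _ _ (lexx t0) t0t1).
move=> /subspace_continuousP/(_ t).
rewrite /= in_itv/= t0t (_ : t <= t + 1); last by lra.
move=> /(_ isT)/cvgrPdistC_le/(_ _ (_ : 0 < `|e| ^+ 2 / 4)).
rewrite divr_gt0 ?exprn_gt0// => /(_ isT)/nbhs_ballP[d3 /= d30 dP3].
pose d := Num.min (Num.min d0 d1) (Num.min (Num.min d2 d3) 1).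
have d_gt0 : 0 < d by rewrite !lt_min d00 d10 d20 d30 ltr01.
(* An interval to the right of [t] stays in the half-line even when [t = t0]. *)
pose I : set (measurableTypeR R) := `[t, t + d[%classic.
have sub : I `<=` N.
  move=> s; rewrite /I/= in_itv/= => /andP[ts std]; apply: Ny => /= eqs.
  have t0s := le_trans t0t ts.
  have std' : `|s - t| < d by rewrite ger0_norm ?subr_ge0// ltrBlDl.
  move: (std'); rewrite !lt_min => /andP[/andP[sd0 sd1] /andP[/andP[sd2 sd3] s1]].
  have h0 := dP0 s t0s sd0; have h1 := dP1 s t0s sd1; have h2 := dP2 s t0s sd2.
  have h3 : `|ip (y 3 s) e - ip (y 3 t) e| <= `|e| ^+ 2 / 4.
    apply: dP3; first by rewrite -ball_normE /= distrC.
    by rewrite in_itv/= t0s; move: s1 => /ltr_normlW; lra.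
  have qs : y 3 s = q s.
    apply/eqP; rewrite -subr_eq0 /q /rhs opprK !addrA.
    by rewrite eqs.
  have hq : `|q s - q t| <= `|e| / 4.
    rewrite (le_trans (rhs_lip _ _ _ _ _ _))//.
    have -> : `|e| / 4 = L * (`|e| / (4 * L)) by field; rewrite gt_eqF.
    have := ler_wpM2l (ltW a2_gt0) h2; have := ler_wpM2l (ltW a1_gt0) h1.
    by have := ler_wpM2l aK h0; move: eps0; rewrite {5}/L; lra.
  have hip := ip_le_norm ip_norm (q s - q t) e.
  have hip2 := ler_wpM2r (ltW ne) hq.
  (* Were the equation true at [s], [|e|^2] would be a sum of two terms of size at most
     [|e|^2 / 4]. *)
  have ee : `|e| ^+ 2 = (ip (y 3 t) e - ip (y 3 s) e) + ip (q s - q t) e.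
    have eE : e = (y 3 t - y 3 s) + (q s - q t) by rewrite qs subrKA.
    by rewrite -(ipE ip_norm) {1}eE (ipDl ip (_ - _)) (ipDl ip (y 3 t)) (ipNl ip).
  have := ler_norm (ip (y 3 t) e - ip (y 3 s) e); rewrite distrC => n1.
  have n2 := ler_norm (ip (q s - q t) e).
  have := exprn_gt0 2 ne; rewrite -/e.
  by move: h3 hip hip2; rewrite !expr2 in ee *; nra.
have : (@lebesgue_measure R I <= @lebesgue_measure R N)%E.
  by apply: le_measure; rewrite ?inE//; exact: measurable_itv.
rewrite muN /I lebesgue_measure_itv/= lte_fin ltrDl d_gt0 -EFinD lee_fin.
by rewrite addrAC subrr add0r leNgt d_gt0.
Qed.

End third_order.

(** * From families of derivatives to strong global solutions *)

Lemma has_derivative_nderive (R : realType) (H : completeNormedModType R)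
    (t0 : R) (p : nat -> R -> H) (n : nat) :
  (forall j t, (j < n)%N -> t0 <= t -> has_derivative t0 (p j) t (p j.+1 t)) ->
  (forall j t, (j <= n)%N -> t0 <= t -> nderive t0 j (p 0%N) t = p j t) /\
  (forall j t, (j < n)%N -> t0 <= t -> derivable_from t0 (nderive t0 j (p 0%N)) t).
Proof.
move=> dp.
have dn j : (j <= n)%N -> (forall t, t0 <= t -> nderive t0 j (p 0%N) t = p j t).
  elim: j => [//|j IH] jn t t0t; have jE := IH (ltnW jn).
  have dj : has_derivative t0 (nderive t0 j (p 0%N)) t (p j.+1 t).
    by apply: eq_has_derivative (dp j t jn t0t) => // s t0s; rewrite jE.
  by have [_] := derive_fromE t0t dj.
split=> j t jn t0t; first exact: dn.
have dj : has_derivative t0 (nderive t0 j (p 0%N)) t (p j.+1 t).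
  by apply: eq_has_derivative (dp j t jn t0t) => // s t0s; rewrite dn// ltnW.
by have [] := derive_fromE t0t dj.
Qed.

Theorem theorem2p11 (R : realType) (H : completeNormedModType R)
    (ip : {dot H for idfun}) (ip_norm : induces_norm ip)
    (Omega : set H) (Omega_nonempty : Omega !=set0)
    (Omega_closed : closed Omega) (Omega_convex : convex_set Omega)
    (a0 a1 a2 gamma t0 : R)
    (a0_gt0 : 0 < a0) (a1_gt0 : 0 < a1) (a2_gt0 : 0 < a2)
    (gamma_gt0 : 0 < gamma) (t0_ge0 : 0 <= t0)
    (F g : H -> H) (eta beta : R) (eta_ge0 : 0 <= eta) (beta_ge0 : 0 <= beta)
    (F_lip : eta.-lipschitz F) (g_lip : beta.-lipschitz g)
    (h : H -> \bar R) (h_proper : proper_on Omega h)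
    (h_convex : convex_on Omega h) (h_lsc : lsc_on Omega h)
    (v0 v1 v2 : H) :
  exists w : R -> H,
    strong_global_solution t0 a0 a1 a2 gamma Omega F g h v0 v1 v2 w /\
    forall w' : R -> H,
      strong_global_solution t0 a0 a1 a2 gamma Omega F g h v0 v1 v2 w' ->
      forall t, t0 <= t -> w' t = w t.
Proof.
pose G x := F x - prox Omega gamma h (F x - gamma *: g x).
(* [F] contributes [eta]; the proximal map doubles the Lipschitz constant [eta + gamma * beta] of
   its argument. *)
pose K := eta + 2 * (eta + gamma * beta).
have K_ge0 : 0 <= K by rewrite !addr_ge0// mulr_ge0// addr_ge0// mulr_ge0// ltW.
have lipF x y : `|F x - F y| <= eta * `|x - y| := F_lip (x, y) (conj I I).
have lipg x y : `|g x - g y| <= beta * `|x - y| := g_lip (x, y) (conj I I).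
have G_lip x y : `|G x - G y| <= K * `|x - y|.
  have -> : G x - G y = (F x - F y) - (prox Omega gamma h (F x - gamma *: g x) -
      prox Omega gamma h (F y - gamma *: g y)) by rewrite /G !opprD !opprK addrACA.
  have hp := prox_lipschitz ip_norm Omega_closed Omega_convex gamma_gt0 h_proper
    h_convex h_lsc (F x - gamma *: g x) (F y - gamma *: g y).
  have hd : `|F x - gamma *: g x - (F y - gamma *: g y)| <=
      (eta + gamma * beta) * `|x - y|.
    have -> : F x - gamma *: g x - (F y - gamma *: g y) =
        (F x - F y) - gamma *: (g x - g y).
      by rewrite scalerBr !opprD !opprK addrACA.
    rewrite (le_trans (ler_normB _ _))// mulrDl lerD// normrZ gtr0_norm//.
    by rewrite -mulrA ler_pM2l.
  rewrite (le_trans (ler_normB _ _))// /K mulrDl lerD//.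
  by rewrite (le_trans hp)// -mulrA ler_pM2l.
have [p [dp lip_p p3 [p00 p10 p20]]] :=
  third_order_exists t0 a0_gt0 a1_gt0 a2_gt0 K_ge0 G_lip v0 v1 v2.
have [dpE dpd] := has_derivative_nderive dp.
have sol : strong_global_solution t0 a0 a1 a2 gamma Omega F g h v0 v1 v2 (p 0%N).
  split=> //.
  - move=> j j3 s0 s1 t0s0 s01; have [C C0 CP] := lip_p j s1 j3.
    apply: (lipschitz_absolutely_continuous ip_norm s01 C0) => s t s0s st ts1.
    have t0s := le_trans t0s0 s0s.
    by rewrite !dpE// ?(le_trans t0s)//; exact: CP.
  - apply: aeW => t t0t; rewrite !dpE// p3 -/(G (p 0%N t)).
    by rewrite -!addrA addNr.
  - by split; rewrite dpE.
exists (p 0%N); split=> // w' [dw' acw' eqw' [w0 w1 w2]].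
pose q j := nderive t0 j w'.
have dq j t : (j < 3)%N -> t0 <= t -> has_derivative t0 (q j) t (q j.+1 t).
  by move=> j3 t0t; apply: derivable_fromP; exact: dw'.
(* The equation for [w'] is upgraded from almost every time to every time, as the Gronwall
   comparison requires. *)
have q3 := third_order_everywhere ip_norm a0_gt0 a1_gt0 a2_gt0 K_ge0 G_lip dq
  (acw' 3%N isT) eqw'.
move=> t t0t.
apply: (third_order_unique ip_norm a0_gt0 a1_gt0 a2_gt0 K_ge0 G_lip dq dp q3) => //.
move=> [|[|[|//]]] _.
- exact: etrans w0 (esym p00).
- exact: etrans w1 (esym p10).
- exact: etrans w2 (esym p20).
Qed.
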